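(* Let $n\ge 3$ and let $G$ be a connected well-covered unicyclic graph of order $2n$. Then $C_n^{\ast}\preceq G\preceq U_n^{\ast}$.
   Context: All graphs are finite, simple and undirected. A graph is well-covered if all of its maximal independent sets have the same size. A connected unicyclic graph is a connected graph containing exactly one cycle. The independence polynomial of a graph $G$ is $I(G,x)=\sum_{k\ge 0} i_kx^k$, where $i_k$ is the number of independent sets of size $k$ in $G$. It is known that the root of $I(G,x)$ of smallest modulus is real and lies in $[-1,0)$; it is denoted $\xi(G)$ (equivalently, the largest real root of $I(G,x)$). For graphs $G,H$, write $H\preceq G$ if and only if $I(H,x)\ge I(G,x)$ for all $x\in[\xi(G),0]$. For a graph $G$, the graph star $G^{\ast}$ is obtained from $G$ by attaching, for each vertex $v$ of $G$, a new vertex $v^{\ast}$ joined by an edge to $v$ only. $C_n$ is the cycle on $n$ vertices. $U_n$ is the graph on $n$ vertices obtained from a triangle by attaching $n-3$ pendant vertices (leaves) to one fixed vertex of the triangle. *)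

(* Defs.v *)
From mathcomp Require Import all_boot all_order all_algebra.
From mathcomp Require Import reals.
From mathcomp Require Import complex.

Set Implicit Arguments.
Unset Strict Implicit.
Unset Printing Implicit Defensive.

Import Order.TTheory GRing.Theory Num.Theory.

Local Open Scope ring_scope.
Local Open Scope complex_scope.

Record graph := Graph {
  vertex :> finType;
  adj : rel vertex;
  adj_sym : symmetric adj;
  adj_irrefl : irreflexive adj
}.

Arguments adj {g} x y.

Definition independent (G : graph) (S : {set G}) : bool :=
  [forall x in S, forall y in S, ~~ adj x y].

Definition well_covered (G : graph) : Prop :=
  forall S1 S2 : {set G},
    maxset (@independent G) S1 -> maxset (@independent G) S2 -> #|S1| = #|S2|.

Definition connected (G : graph) : Prop :=
  forall x y : G, connect (@adj G) x y.

(* A cycle is identified with its edge set, so that the choice of a starting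
   vertex and of a direction of traversal does not matter. *)
Definition is_cycle (G : graph) (E : {set {set G}}) : Prop :=
  exists c : seq G,
    [/\ (3 <= size c)%N, ucycle (@adj G) c
      & E = [set [set x; next c x] | x in c]].

Definition connected_unicyclic (G : graph) : Prop :=
  connected G /\ exists! E : {set {set G}}, is_cycle E.

Definition num_indep (G : graph) (k : nat) : nat :=
  #|[set S : {set G} | independent S & #|S| == k]|.

Definition indep_poly (A : nzSemiRingType) (G : graph) : {poly A} :=
  \poly_(k < #|G|.+1) (num_indep G k)%:R.

(* [is_xi G r] says that r is xi(G): the real number r is a root of I(G, x) of
   smallest modulus among all complex roots.  At most one r qualifies, since
   I(G, x) has no root x >= 0. *)
Definition is_xi (R : realType) (G : graph) (r : R) : Prop :=
  root (indep_poly R G) r /\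
  forall z : R[i], root (indep_poly R[i] G) z -> `|r%:C| <= `|z|.

(* The existence of xi(G) is part of the assertion, so that the relation never
   holds vacuously. *)
Definition preceq (R : realType) (H G : graph) : Prop :=
  exists2 xi : R, is_xi G xi &
    forall x : R, xi <= x <= 0 -> (indep_poly R G).[x] <= (indep_poly R H).[x].

(* In the graph star, [inr v] is the leaf attached to the vertex [inl v]. *)
Section Star.
Variable G : graph.

Definition star_adj (x y : G + G) : bool :=
  match x, y with
  | inl u, inl v => adj u v
  | inl u, inr v | inr u, inl v => u == v
  | inr _, inr _ => false
  end.

Lemma star_adj_sym : symmetric star_adj.
Proof. by case=> u [] v //=; [exact: adj_sym | exact: eq_sym..]. Qed.

Lemma star_adj_irrefl : irreflexive star_adj.
Proof. by case=> u //=; exact: adj_irrefl. Qed.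

Definition star : graph := Graph star_adj_sym star_adj_irrefl.

End Star.

Section CycleGraph.
Variable n : nat.

Definition cycle_adj (i j : 'I_n) : bool :=
  (i != j) && ((j == ordS i) || (i == ordS j)).

Lemma cycle_adj_sym : symmetric cycle_adj.
Proof. by move=> i j; rewrite /cycle_adj eq_sym orbC. Qed.

Lemma cycle_adj_irrefl : irreflexive cycle_adj.
Proof. by move=> i; rewrite /cycle_adj eqxx. Qed.

Definition cycle_graph : graph := Graph cycle_adj_sym cycle_adj_irrefl.

(* The triangle is {0, 1, 2} and the leaves 3, ..., n - 1 hang from 0. *)
Definition U_adj (i j : 'I_n) : bool :=
  (i != j) && [|| i == 0%N :> nat, j == 0%N :> nat | (i < 3)%N && (j < 3)%N].

Lemma U_adj_sym : symmetric U_adj.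
Proof. by move=> i j; rewrite /U_adj eq_sym orbCA andbC [(j < 3)%N && _]andbC andbC. Qed.

Lemma U_adj_irrefl : irreflexive U_adj.
Proof. by move=> i; rewrite /U_adj eqxx. Qed.

Definition U_graph : graph := Graph U_adj_sym U_adj_irrefl.

End CycleGraph.

(* Main.v *)
(* A connected well-covered unicyclic graph [G] of order [2n] has an independent
   set of size at least [n], since deleting a vertex of its cycle leaves a forest.
   Berge's inequality [|A| <= |N(A)|] for independent [A] and Hall's theorem then
   give a perfect matching such that every maximal independent set meets every
   matching edge; hence if [x y] is a matching edge, every other neighbour of [x]
   is adjacent to every other neighbour of [y].  As [G] has a single cycle, at
   most one matching edge is not pendant.  Contracting the matching gives a
   connected graph [H] with [n] vertices and [n] edges, and
   [I(G, x) = (1 + x)^n I(H, y)] with [y = x / (1 + x)], as if [G] were the graph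
   star of [H] (an exceptional matching edge lying on a 4-cycle does not change
   the polynomial).  This reduces the theorem to comparing [I(H, y)] with
   [I(C_n, y)] and [I(U_n, y)] for [y < 0], on the range where all induced
   subgraphs of [H], resp. [U_n], have a positive value.

   Upper bound.  The ratios [I(K) / I(K - w)] of connected induced subgraphs [K]
   on [m] vertices are at most those of a path (removing an endpoint), and, when
   [K] has at least [m] edges, at most [c_m / c_(m-1)] with [c_k] the value for
   the [k]-cycle; the induction splits [K] at [w] when [w] is a cut vertex.
   Lower bound.  Remove leaves; if none is left the graph is 2-regular, and
   deleting one vertex leaves a forest, which is compared with a star.

   That the root of smallest modulus is real comes from the fact that deletion
   ratios at [z] dominate, in modulus, those at [- `|z|]. *)
Require Import Defs.
From mathcomp Require Import all_boot all_order all_algebra.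
From mathcomp Require Import reals.
From mathcomp Require Import complex polyrcf.
From mathcomp Require Import zify ring lra.

Set Implicit Arguments.
Unset Strict Implicit.
Unset Printing Implicit Defensive.

Import Order.TTheory GRing.Theory Num.Theory.

Local Open Scope ring_scope.

(** * Independence polynomials of induced subgraphs *)

Lemma set_ind (T : finType) (P : {set T} -> Prop) :
  (forall S : {set T}, (forall A : {set T}, A \proper S -> P A) -> P S) ->
  forall S, P S.
Proof.
move=> step S; have [m] := ubnP #|S|; elim: m S => // m IH S leS.
by apply: step => A /proper_card ltA; apply: IH; apply: leq_trans ltA _.
Qed.

Section IndependencePolynomial.
Variable G : graph.
Implicit Types (S A B : {set G}) (u v w : G).

(** Defined over any semiring: [x = 'X] gives the polynomial itself, and one deletion recurrence
    serves real, complex and polynomial arguments. *)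
Definition ip (K : nzSemiRingType) S (x : K) : K :=
  \sum_(A : {set G} | (A \subset S) && independent A) x ^+ #|A|.

Definition ndel S v := [set u in S :\ v | ~~ adj v u].

Lemma ndel_sub S v : ndel S v \subset S :\ v.
Proof. by apply/subsetP => u; rewrite inE => /andP[]. Qed.

Lemma independentP A :
  reflect {in A &, forall u v, ~~ adj u v} (independent A).
Proof.
apply: (iffP forall_inP) => [h u v uA vA | h u uA].
  exact: (forall_inP (h u uA)).
by apply/forall_inP => v vA; exact: h.
Qed.

Lemma independentS A B : A \subset B -> independent B -> independent A.
Proof.
by move=> /subsetP AB /independentP h; apply/independentP => u v /AB uB /AB; exact: h.
Qed.

Lemma independent0 : independent (set0 : {set G}).
Proof. by apply/independentP => u v; rewrite inE. Qed.

Lemma independentU1 v B :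
  v \notin B -> independent (v |: B) = independent B && [forall u in B, ~~ adj v u].
Proof.
move=> vB; apply/independentP/andP => [h | [/independentP hB /forall_inP hv]].
  split; first by apply/independentP => u w uB wB; apply: h; rewrite in_setU1 ?uB ?wB orbT.
  by apply/forall_inP => u uB; apply: h; rewrite in_setU1 ?eqxx ?uB ?orbT.
move=> u w /setU1P[->|uB] /setU1P[->|wB]; rewrite ?adj_irrefl //.
- exact: hv.
- by rewrite adj_sym hv.
- exact: hB.
Qed.

Lemma ip0 (K : nzSemiRingType) (x : K) : ip set0 x = 1.
Proof.
rewrite /ip (big_pred1 set0) ?cards0 // => A.
rewrite subset0 andb_idr //; by move/eqP->; exact: independent0.
Qed.

(** Independent sets avoiding [v] give the first term; those containing [v] arise by adding [v] to
    an independent subset of [ndel S v]. *)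
Lemma ip_del (K : nzSemiRingType) S v (x : K) :
  v \in S -> ip S x = ip (S :\ v) x + x * ip (ndel S v) x.
Proof.
move=> vS; rewrite /ip (bigID (fun A : {set G} => v \in A)) /= addrC; congr (_ + _).
  apply: eq_bigl => A; rewrite subsetD1; case: (A \subset S); case: (v \in A) => //=;
  by rewrite ?andbT ?andbF.
rewrite big_distrr /=.
rewrite (reindex_onto (fun B => v |: B) (fun A => A :\ v)) /=; last first.
  by move=> A /andP[_ vA]; rewrite setD1K.
apply: eq_big => [B | B /andP[/andP[_ _]]].
  have [vB | vB] := boolP (v \in B).
    have -> : (B \subset ndel S v) = false.
      by apply/negbTE/subsetPn; exists v => //; rewrite !inE eqxx.
    rewrite /= [_ == B](_ : _ = false) ?andbF //.
    by apply/negbTE/eqP => eB; move: vB; rewrite -eB !inE eqxx.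
  rewrite setU11 andbT setU1K // eqxx andbT independentU1 //.
  rewrite [LHS]andbCA [RHS]andbC; congr (_ && _).
  rewrite subUset sub1set vS /=.
  apply/andP/subsetP => [[/subsetP BS /forall_inP hB] u uB | h].
    by rewrite !inE (BS _ uB) (hB _ uB) !andbT; apply: contraNneq vB => <-.
  split; first by apply/subsetP => u /h; rewrite !inE => /andP[/andP[]].
  by apply/forall_inP => u /h; rewrite !inE => /andP[_].
move=> /eqP eB; have vB : v \notin B by rewrite -eB !inE eqxx.
by rewrite cardsU1 vB add1n exprS.
Qed.

Lemma ip_at0 (K : nzSemiRingType) S : ip S (0 : K) = 1.
Proof.
have [m] := ubnP #|S|; elim: m S => // m IH S; have [->|[v vS]] := set_0Vmem S.
  by rewrite ip0.
by rewrite (cardsD1 v) vS => h; rewrite (ip_del _ vS) mul0r addr0 IH.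
Qed.

Lemma ip_rmorph (K L : nzSemiRingType) (f : {rmorphism K -> L}) S x :
  f (ip S x) = ip S (f x).
Proof. by rewrite rmorph_sum; apply: eq_bigr => A _; rewrite rmorphXn. Qed.

Lemma ip_horner (K : comNzRingType) S (x : K) : (ip S 'X).[x] = ip S x.
Proof. by rewrite horner_sum; apply: eq_bigr => A _; rewrite hornerXn. Qed.

Lemma indep_polyE (K : nzSemiRingType) : indep_poly K G = ip setT 'X.
Proof.
rewrite /indep_poly poly_def /ip.
(* Independent sets are grouped by size; [inord] is faithful since no size exceeds [#|G|]. *)
rewrite (partition_big (fun A : {set G} => inord #|A| : 'I_#|G|.+1) xpredT) //=.
apply: eq_bigr => k _; rewrite /num_indep -sum1_card natr_sum scaler_suml.
have cE A : (inord #|A| == k) = (#|A| == k :> nat).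
  by rewrite -val_eqE /= inordK // ltnS max_card.
apply: eq_big => [A | A]; first by rewrite inE subsetT cE.
by rewrite inE => /andP[_ /eqP->]; rewrite scale1r.
Qed.

Lemma horner_indep_poly (K : comNzRingType) (x : K) :
  (indep_poly K G).[x] = ip setT x.
Proof. by rewrite indep_polyE ip_horner. Qed.

Lemma ipU (K : comNzRingType) A B (x : K) :
  [disjoint A & B] -> {in A & B, forall u v, ~~ adj u v} ->
  ip (A :|: B) x = ip A x * ip B x.
Proof.
have [m] := ubnP #|A|; elim: m A B => // m IH A B leA dAB nAB.
have [->|[v vA]] := set_0Vmem A; first by rewrite set0U ip0 mul1r.
have vB : v \notin B by rewrite (disjointFr dAB).
have ltA : (#|A :\ v| < m)%N by move: leA; rewrite (cardsD1 v) vA.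
rewrite (ip_del _ vA) (@ip_del _ (A :|: B) v); last by rewrite inE vA.
have -> : (A :|: B) :\ v = (A :\ v) :|: B.
  apply/setP => u; rewrite !inE; have [->|] := eqVneq u v => //=.
  by rewrite (negPf vB).
have -> : ndel (A :|: B) v = ndel A v :|: B.
  apply/setP => u; rewrite !inE; have [->|uv] := eqVneq u v => /=.
    by rewrite (negPf vB).
  have [uB|uB] := boolP (u \in B); last by rewrite !orbF.
  by rewrite !orbT (nAB v u).
have sub1 (C : {set G}) : C \subset A :\ v -> ip (C :|: B) x = ip C x * ip B x.
  move=> sC; have /subsetP CA := subset_trans sC (subD1set A v).
  apply: IH.
  - exact: leq_ltn_trans (subset_leq_card sC) ltA.
  - by apply: disjointWl dAB; apply/subsetP.
  - by move=> u w /CA uA; exact: nAB.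
by rewrite !sub1 ?ndel_sub // mulrDl mulrA.
Qed.

End IndependencePolynomial.

(** * Positivity and the root of smallest modulus *)

Section Good.
Variables (F : numDomainType) (G : graph).
Implicit Types (S A B : {set G}) (x : F).

(** Positivity of all induced subgraphs at a single point: it makes every deletion ratio positive
    and passes to subsets. *)
Definition good S x := forall A, A \subset S -> 0 < ip A x.

Lemma goodS A S x : A \subset S -> good S x -> good A x.
Proof. by move=> AS gS B BA; apply: gS; apply: subset_trans AS. Qed.

Lemma ip_anti A B x : x <= 0 -> good B x -> A \subset B -> ip B x <= ip A x.
Proof.
move=> x0; elim/set_ind: B A => B IH A gB AB.
have [->|neAB] := eqVneq A B; first by [].
have /properP[_ [v vB vA]] : A \proper B by rewrite properEneq neAB.
have gBv := goodS (subD1set B v) gB.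
apply: le_trans (IH _ (properD1 vB) A gBv _); last by rewrite subsetD1 AB.
rewrite (ip_del _ vB) gerDl mulr_le0_ge0 // ltW //.
by apply: gBv; exact: ndel_sub.
Qed.

(* Scott-Sokal: the deletion ratios at [z] dominate those at [- `|z|]. *)
Lemma norm_ip_ratio A B (t z : F) : 0 <= t -> `|z| <= t -> good B (- t) ->
  A \subset B -> ip B (- t) * `|ip A z| <= `|ip B z| * ip A (- t).
Proof.
move=> t0 zt; elim/set_ind: B A => B IH A gB AB.
have [->|neAB] := eqVneq A B; first by rewrite mulrC.
have /properP[_ [v vB vA]] : A \proper B by rewrite properEneq neAB.
have gBv := goodS (subD1set B v) gB.
have pBv := properD1 vB.
have ABv : A \subset B :\ v by rewrite subsetD1 AB.
have fBv : 0 < ip (B :\ v) (- t) by apply: gBv.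
rewrite -(ler_pM2l fBv).
have h1 := IH _ pBv A gBv ABv.
have h2 := IH _ pBv (ndel B v) gBv (ndel_sub B v).
have h3 : `|ip (B :\ v) z| - t * `|ip (ndel B v) z| <= `|ip B z|.
  rewrite (ip_del z vB) -[X in _ <= `|_ + X|]opprK.
  apply: le_trans (lerB_normD _ _); rewrite lerD2l lerN2 opprK normrM.
  by rewrite ler_wpM2r.
have step : ip B (- t) * `|ip (B :\ v) z| <= `|ip B z| * ip (B :\ v) (- t).
  apply: le_trans (ler_wpM2r (ltW fBv) h3).
  rewrite (ip_del _ vB) mulNr !mulrBl [X in _ <= X - _]mulrC lerD2l lerN2.
  by rewrite -!mulrA ler_wpM2l // [leLHS]mulrC [leRHS]mulrC.
have fA : 0 < ip A (- t) by apply: gB.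
have fB : 0 < ip B (- t) by apply: gB.
rewrite mulrCA [leRHS]mulrA [X in _ <= X * _]mulrC.
apply: le_trans (ler_wpM2l (ltW fB) h1) _.
by rewrite mulrA ler_wpM2r // ltW.
Qed.

(** The ratio bound with [A] empty bounds the modulus at [z] below by [ip B (- t)], so no zero lies
    in the disc of radius [t]. *)
Lemma norm_ip_gt0 B (t z : F) : 0 <= t -> `|z| <= t -> good B (- t) ->
  0 < `|ip B z|.
Proof.
move=> t0 zt gB; have := norm_ip_ratio t0 zt gB (sub0set B).
rewrite !ip0 normr1 !mulr1; apply: lt_le_trans; exact: gB.
Qed.

End Good.

(** * Largest real roots and positivity on induced subgraphs *)

Section RealRoots.
Variable R : rcfType.

Lemma ge0_left_limit (p : {poly R}) (a b : R) : a < b ->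
  (forall y, a < y <= b -> 0 <= p.[y]) -> 0 <= p.[a].
Proof.
move=> ab h; rewrite leNgt; apply/negP => pa.
have e0 : 0 < - p.[a] by rewrite oppr_gt0.
have [d d0 hd] := poly_cont a p e0.
pose y := Num.min b (a + d / 2).
have ay : a < y by rewrite lt_min ab ltrDl divr_gt0.
have yb : y <= b by rewrite ge_min lexx.
have yd : y <= a + d / 2 by rewrite ge_min lexx orbT.
have := hd y; rewrite ltr_distl.
have -> : a - d < y < a + d by apply/andP; split; lra.
move=> /(_ isT); rewrite ltr_distl => /andP[_].
have := h y; rewrite ay yb => /(_ isT); lra.
Qed.

Lemma le_left_limit (p q : {poly R}) (a b : R) : a < b ->
  (forall y, a < y <= b -> p.[y] <= q.[y]) -> p.[a] <= q.[a].
Proof.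
move=> ab h; rewrite -subr_ge0 -hornerN -hornerD.
apply: (@ge0_left_limit _ a b) => // y yab.
by rewrite hornerD hornerN subr_ge0 h.
Qed.

Lemma last_root (p : {poly R}) (a b : R) : a <= b -> p.[a] <= 0 -> 0 < p.[b] ->
  exists r, [/\ a <= r < b, p.[r] = 0 & forall y, r < y <= b -> 0 < p.[y]].
Proof.
move=> ab pa pb.
have pn0 : p != 0 by apply: contraTneq pb => ->; rewrite horner0 ltxx.
(* By the intermediate value theorem, a positive value at [b] and no root strictly between [y] and
   [b] force positivity. *)
have nolow y : a <= y <= b -> (forall z, y < z < b -> p.[z] != 0) ->
    forall z, y < z <= b -> 0 < p.[z].
  move=> /andP[ay yb] h z /andP[yz]; rewrite le_eqVlt => /predU1P[->//|zb].
  rewrite lt_def h ?yz //= leNgt; apply/negP => pz.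
  have [|c /andP[]] := @poly_ivtoo _ p z b (ltW zb).
    by rewrite pmulr_llt0.
  rewrite ?bnd_simp => zc cb; apply/negP; apply: h.
  by rewrite (lt_trans yz zc).
have := @prev_rootP _ p a b.
case: prev_rootP => [p0|y _ py yab h|c _ hc h] _; first by rewrite p0 eqxx in pn0.
  exists y; have /andP[ay yb] : a < y < b by move: yab; rewrite in_itv.
  split=> //; first by rewrite (ltW ay) yb.
  apply: nolow; first by rewrite (ltW ay) (ltW yb).
  by move=> z hz; rewrite -rootE; apply: h; rewrite in_itv.
have ltab : a < b.
  by rewrite lt_neqAle ab andbT; apply: contraTneq pb => <-; rewrite -leNgt.
have pos : forall y, a < y <= b -> 0 < p.[y].
  apply: nolow; first by rewrite lexx.
  by move=> z hz; rewrite -rootE; apply: h; rewrite in_itv.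
exists a; split => //; first by rewrite lexx.
by apply/le_anti; rewrite pa (ge0_left_limit ltab) // => y /pos/ltW.
Qed.

Variable G : graph.
Implicit Types (S A B : {set G}) (x : R).

(** If some [ip (S :\ v)] failed to stay positive, then at its last root [r] the recurrence would
    give [ip S r = r * ip (ndel S v) r <= 0]. *)
Lemma pos_good S x : x <= 0 ->
  (forall y, x <= y <= 0 -> 0 < ip S y) -> good S x.
Proof.
elim/set_ind: S x => S IH x x0 pos A AS.
have [->|neAS] := eqVneq A S; first by apply: pos; rewrite lexx.
have /properP[_ [v vS vA]] : A \proper S by rewrite properEneq neAS.
have pSv := properD1 vS.
apply: (IH _ pSv x) => //; last by rewrite subsetD1 AS.
move=> y /andP[xy y0]; rewrite ltNge; apply/negP => ipy.
have [||r [/andP[yr r0] ipr posr]] := @last_root (ip (S :\ v) 'X) y 0 y0.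
- by rewrite ip_horner.
- by rewrite ip_horner ip_at0.
(* To the right of [r], induction makes [ndel S v] positive; at [r] itself the limit still gives a
   nonnegative value. *)
have ge0 : 0 <= ip (ndel S v) r.
  rewrite -ip_horner; apply: (ge0_left_limit r0) => z /andP[rz z0].
  rewrite ip_horner ltW //; apply: (IH _ pSv z) => //; last exact: ndel_sub.
  move=> u /andP[zu u0]; rewrite -ip_horner; apply: posr.
  by rewrite (lt_le_trans rz zu).
have := pos r; rewrite (ip_del _ vS) -ip_horner ipr add0r (le_trans xy yr) (ltW r0).
by move=> /(_ isT); apply/negP; rewrite -leNgt mulr_le0_ge0 // ltW.
Qed.

Lemma good_gtN1 S x : x <= 0 -> S != set0 -> good S x -> -1 < x.
Proof.
move=> x0 /set0Pn[v vS] gS; have := gS [set v].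
have -> : ip [set v] x = 1 + x.
  rewrite (@ip_del _ _ _ v) ?set11 // setDv ip0.
  have -> : ndel [set v] v = set0 by apply/eqP; rewrite -subset0 -(setDv [set v]) ndel_sub.
  by rewrite ip0 mulr1.
rewrite sub1set => /(_ vS); lra.
Qed.

Lemma largest_root S : S != set0 -> exists r : R,
  [/\ -1 <= r < 0, ip S r = 0 & forall y, r < y <= 0 -> 0 < ip S y].
Proof.
move=> S0.
have [[x [xN1 x0 ipx]]|nox] :=
  boolp.pselect (exists x : R, [/\ -1 <= x, x <= 0 & ip S x <= 0]).
  have [||r [/andP[xr r0] ipr posr]] := @last_root (ip S 'X) x 0 x0.
  - by rewrite ip_horner.
  - by rewrite ip_horner ip_at0.
  exists r; split; first by rewrite (le_trans xN1).
    by rewrite -ip_horner.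
  by move=> y /posr; rewrite ip_horner.
(* Otherwise [S] is positive on all of [[-1, 0]], hence good at -1, where a single vertex has value
   0. *)
suff : (-1 : R) < -1 by rewrite ltxx.
apply: (@good_gtN1 S) => //; first by rewrite lerN10.
apply: pos_good => [|y /andP[y1 y0]]; first by rewrite lerN10.
by rewrite ltNge; apply/negP => ipy; apply: nox; exists y.
Qed.

End RealRoots.

Section SmallestModulus.

Local Open Scope complex_scope.

(** A complex root of modulus [t < - r] contradicts [norm_ip_gt0], because every induced subgraph is
    positive at [- t]. *)
Lemma is_xi_largest_root (R : realType) (G : graph) (r : R) :
  r < 0 -> ip [set: G] r = 0 -> (forall y, r < y <= 0 -> 0 < ip [set: G] y) ->
  is_xi G r.
Proof.
move=> r0 ipr posr; split; first by rewrite rootE horner_indep_poly ipr.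
move=> z; rewrite rootE horner_indep_poly => /eqP ipz.
rewrite !normc_def lecR leNgt; apply/negP.
rewrite /= expr0n /= addr0 sqrtr_sqr ltr0_norm //; set t := Num.sqrt _ => ltr.
have t0 : 0 <= t by rewrite sqrtr_ge0.
have gt : good [set: G] (- t).
  apply: pos_good; first by rewrite oppr_le0.
  by move=> y /andP[ty y0]; apply: posr; rewrite y0 andbT; lra.
have : 0 < `|ip [set: G] z|.
  apply: (@norm_ip_gt0 _ _ _ t%:C).
  - by rewrite ler0c.
  - by rewrite normc_def.
  move=> A AS; have -> : - t%:C = (- t)%:C by rewrite rmorphN.
  by rewrite -ip_rmorph -(rmorph0 (real_complex R)) ltcR; exact: gt.
by rewrite ipz normr0 ltxx.
Qed.

End SmallestModulus.

(** * Path and cycle recurrences; connectivity *)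

Section Recurrence.
Variable K : comNzRingType.
Implicit Types (a b x : K).

Fixpoint lrec a b x n : K :=
  if n is m.+1 then (if m is k.+1 then lrec a b x m + x * lrec a b x k else b) else a.

(* [qp x k.+1] is the independence polynomial of the path on [k] vertices, and
   [cp x k] that of the cycle on [k >= 3] vertices. *)
Definition qp := lrec 1 1.
Definition cp := lrec 2%:R 1.

Lemma lrecSS a b x n : lrec a b x n.+2 = lrec a b x n.+1 + x * lrec a b x n.
Proof. by []. Qed.

Lemma qpSS x n : qp x n.+2 = qp x n.+1 + x * qp x n.
Proof. by []. Qed.

Lemma cpSS x n : cp x n.+2 = cp x n.+1 + x * cp x n.
Proof. by []. Qed.

(** For [qp] this is deletion of an inner vertex of a path. It evaluates the products that arise at
    a cut vertex. *)
Lemma lrec_add a b x i j : lrec a b x (i + j).+2 =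
  lrec a b x i.+1 * qp x j.+1 + x * lrec a b x i * qp x j.
Proof.
(* Two consecutive values of [j] carry the induction through the two-step recurrence. *)
suff [] : lrec a b x (i + j).+2 =
    lrec a b x i.+1 * qp x j.+1 + x * lrec a b x i * qp x j /\
  lrec a b x (i + j).+3 =
    lrec a b x i.+1 * qp x j.+2 + x * lrec a b x i * qp x j.+1 by [].
elim: j => [|j [IH1 IH2]].
  by rewrite addn0 !lrecSS /qp /= !mulr1; split=> //; ring.
rewrite addnS; split=> //; rewrite lrecSS IH1 IH2 !qpSS; ring.
Qed.

(** Deletion of one vertex of a cycle, extended down to indices too small for a cycle. *)
Lemma cpE x n : cp x n.+2 = qp x n.+2 + x * qp x n.
Proof.
suff [] : cp x n.+2 = qp x n.+2 + x * qp x n /\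
   cp x n.+3 = qp x n.+3 + x * qp x n.+1 by [].
elim: n => [|n [IH1 IH2]]; first by rewrite /cp /qp /=; split; ring.
split=> //; rewrite cpSS IH1 IH2 !qpSS; ring.
Qed.

(** The Casoratian of the two solutions: it starts at 1 and each step multiplies it by [- x]. *)
Lemma cp_qp_det x n : cp x n * qp x n.+1 - cp x n.+1 * qp x n = (- x) ^+ n.
Proof.
elim: n => [|n IH]; first by rewrite /cp /qp /=; ring.
by rewrite exprS -IH cpSS qpSS; ring.
Qed.

End Recurrence.

Section RecurrenceSign.
Variables (F : realFieldType) (x : F).
Hypothesis x0 : x < 0.

Lemma qp_anti n : (forall i, (i <= n)%N -> 0 < qp x i) -> qp x n.+1 <= qp x n.
Proof.
case: n => [|n] pos; first by rewrite lexx.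
rewrite qpSS gerDl mulr_le0_ge0 ?(ltW x0) // ltW //.
exact: (pos n (leqnSn _)).
Qed.

Lemma cp_anti n : (forall i, (i <= n)%N -> 0 < cp x i) -> cp x n.+1 <= cp x n.
Proof.
case: n => [|n] pos; first by rewrite /cp /=; lra.
rewrite cpSS gerDl mulr_le0_ge0 ?(ltW x0) // ltW //.
exact: (pos n (leqnSn _)).
Qed.

Lemma lrec_add_le a b i j : lrec a b x i.+1 <= lrec a b x i -> 0 <= qp x j ->
  lrec a b x (i + j).+2 <= lrec a b x i.+1 * qp x j.+2.
Proof.
move=> anti q0; rewrite lrec_add qpSS mulrDr lerD2l mulrCA mulrA.
by rewrite ler_wpM2r // ler_wnM2l // ltW.
Qed.

(** By the Casoratian identity, [cp x m * qp x m.+1] is [(- x) ^+ m] plus [cp x m.+1 * qp x m], so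
    positivity descends. *)
Lemma cp_pos_down m : (forall i, (i <= m)%N -> 0 < qp x i) -> 0 < cp x m ->
  forall i, (i <= m)%N -> 0 < cp x i.
Proof.
elim: m => [|m IH] pos cm i; first by rewrite leqn0 => /eqP->.
rewrite leq_eqVlt => /predU1P[->//|]; apply: IH => [j /leqW|]; first exact: pos.
have := cp_qp_det x m; have h1 := pos m.+1 (leqnn _); have h2 := pos m (leqnSn _).
have h3 : 0 <= (- x) ^+ m by rewrite exprn_ge0 // oppr_ge0 ltW.
move=> /(canRL (subrK _)) e; rewrite -(pmulr_lgt0 _ h1) e.
by rewrite ltr_wpDl // mulr_gt0.
Qed.

End RecurrenceSign.

(** * Connected induced subgraphs and cut vertices *)

Section Connectivity.
Variable G : graph.
Implicit Types (S X Y A B K : {set G}) (u v w : G).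

(** Connectivity through edge cuts, which avoids paths inside [S]; the empty set counts as
    connected. *)
Definition conn S : bool :=
  [forall X : {set G}, (X \proper S) && (X != set0) ==>
     [exists u in X, [exists v in S :\: X, adj u v]]].

Lemma connP S : reflect
  (forall X, X \proper S -> X != set0 -> exists u v, [/\ u \in X, v \in S, v \notin X & adj u v])
  (conn S).
Proof.
apply: (iffP forallP) => [h X XS X0|h X].
  have := h X; rewrite XS X0 => /exists_inP[u uX /exists_inP[v]].
  by rewrite inE => /andP[vX vS] uv; exists u, v.
apply/implyP => /andP[XS X0]; have [u [v [uX vS vX uv]]] := h X XS X0.
by apply/exists_inP; exists u => //; apply/exists_inP; exists v; rewrite // inE vX.
Qed.

Lemma conn1 v : conn [set v].
Proof.
by apply/connP => X; rewrite properE subset1 => /andP[/orP[]/eqP-> //]; rewrite ?subxx ?eqxx.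
Qed.

Lemma connU1 S u v : conn S -> u \in S -> adj u v -> conn (v |: S).
Proof.
move=> /connP cS uS uv; apply/connP => X XvS X0.
have [SX|nSX] := boolP (S \subset X).
  exists u, v; rewrite setU11 (subsetP SX) //; split=> //.
  apply: contraL XvS => vX; rewrite properE negb_and negbK.
  by rewrite subUset sub1set vX SX orbT.
have /subsetPn[z zS zX] := nSX.
have [XS0|XS0] := eqVneq (X :&: S) set0.
  have XS : X \subset [set v].
    apply/subsetP => y yX; have := subsetP (proper_sub XvS) y yX.
    rewrite !inE => /predU1P[->|yS]; first by rewrite eqxx.
    by have : y \in X :&: S; [rewrite inE yX | rewrite XS0 inE].
  have vX : v \in X by case/set0Pn: X0 => y yX; rewrite -(set1P (subsetP XS y yX)).
  exists v, u; rewrite in_setU1 uS orbT adj_sym; split=> //.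
  by apply/negP => uX; have : u \in X :&: S; [rewrite inE uX | rewrite XS0 inE].
have [|a [b [aX bS bX ab]]] := cS (X :&: S) _ XS0.
  by rewrite properE subsetIr; apply/subsetPn; exists z; rewrite // inE (negPf zX).
exists a, b; move: aX bX; rewrite !inE bS orbT andbT => /andP[-> _] ->.
by split.
Qed.

Lemma conn_neighbor S w : conn S -> w \in S -> (1 < #|S|)%N ->
  exists2 z, z \in S :\ w & adj w z.
Proof.
move=> /connP cS wS S1; have [||u [v [/set1P-> vS vw wv]]] := cS [set w].
- by rewrite properEcard sub1set wS cards1.
- by apply/set0Pn; exists w; rewrite set11.
by exists v => //; rewrite !inE vS andbT; move: vw; rewrite inE.
Qed.

Lemma conn_sub S j : conn S -> (0 < j <= #|S|)%N ->
  exists A, [/\ A \subset S, conn A & #|A| = j].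
Proof.
move=> cS; elim: j => // -[_|j IH] /andP[_ jS].
  by have /card_gt0P[v vS] := jS; exists [set v]; rewrite sub1set vS conn1 cards1.
have [A [AS cA cardA]] := IH (ltnW jS).
have [||u [v [uA vS vA uv]]] := connP _ cS A.
- by rewrite properEcard AS cardA.
- by rewrite -card_gt0 cardA.
exists (v |: A); split; first by rewrite subUset sub1set vS.
  exact: connU1 uv.
by rewrite cardsU1 vA cardA.
Qed.

(** A connected subset with one vertex fewer exists by growth, and the vertex it misses is not a cut
    vertex. *)
Lemma conn_noncut S : conn S -> (1 < #|S|)%N -> exists2 w, w \in S & conn (S :\ w).
Proof.
move=> cS S1; have [|A [AS cA cardA]] := @conn_sub S #|S|.-1 cS; first by lia.
have [w] : exists w, S :\: A = [set w].
  apply/cards1P; rewrite cardsD (setIidPr AS) cardA; apply/eqP; lia.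
move=> eSA; have : w \in S :\: A by rewrite eSA set11.
rewrite inE => /andP[wA wS]; exists w => //.
suff -> : S :\ w = A by [].
apply/eqP; rewrite eq_sym eqEcard subsetD1 AS wA /=.
by have := cardsD1 w S; rewrite wS cardA => ->.
Qed.

(** [X] and [Y] may each be a union of components of [S :\ w]. Both halves keep [w] and stay
    connected, so inductions apply to them. *)
Variant cut_at S w X Y : Prop := CutAt of
  S :\ w = X :|: Y & X != set0 & Y != set0 & [disjoint X & Y] &
  {in X & Y, forall u v, ~~ adj u v} & conn (w |: X) & conn (w |: Y).

Lemma cut_at_sym S w X Y : cut_at S w X Y -> cut_at S w Y X.
Proof.
case=> e X0 Y0 d n cX cY; split=> //; first by rewrite setUC.
  by rewrite disjoint_sym.
by move=> u v uY vX; rewrite adj_sym n.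
Qed.

Lemma conn_cut S w : conn S -> w \in S ->
  conn (S :\ w) \/ exists X Y, cut_at S w X Y.
Proof.
move=> cS wS; have [|nc] := boolP (conn (S :\ w)); first by left.
right; move: nc; rewrite negb_forall => /existsP[X]; rewrite negb_imply.
case/andP=> /andP[XS X0] nX; set Y := (S :\ w) :\: X.
have SXY : S :\ w = X :|: Y.
  apply/setP => u; rewrite !inE; have [uX|//] := boolP (u \in X).
  by have := subsetP (proper_sub XS) u uX; rewrite !inE.
have Y0 : Y != set0 by rewrite setD_eq0; move: XS; rewrite properE => /andP[].
have dXY : [disjoint X & Y].
  by rewrite -setI_eq0; apply/eqP/setP => u; rewrite !inE; case: (u \in X).
have nXY : {in X & Y, forall u v, ~~ adj u v}.
  move=> u v uX vY; apply: contra nX => uv; apply/exists_inP; exists u => //.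
  by apply/exists_inP; exists v.
have wX : w \notin X by apply/negP => /(subsetP (proper_sub XS)); rewrite !inE eqxx.
have wY : w \notin Y by rewrite !inE eqxx /= andbF.
have memS u : u \in S = [|| u == w, u \in X | u \in Y].
  have /setP/(_ u) := SXY; rewrite in_setU in_setD1 => <-.
  by have [->|] := eqVneq u w; rewrite ?wS.
(* A cut of [w |: A] is, up to complement, a cut of S avoiding w. *)
have half (A B : {set G}) : w \notin A -> w \notin B -> {in A & B, forall u v, ~~ adj u v} ->
    (forall u, u \in S = [|| u == w, u \in A | u \in B]) -> conn (w |: A).
  move=> wA wB nAB mem; have key (Z : {set G}) : Z \subset A -> Z != set0 ->
      exists u v, [/\ u \in Z, v \in w |: A, v \notin Z & adj u v].
    move=> ZA Z0; have [|u [v [uZ vS vZ uv]]] := connP _ cS Z _ Z0.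
      rewrite properE; apply/andP; split.
        by apply/subsetP => u /(subsetP ZA) uA; rewrite mem uA orbT.
      apply/subsetPn; exists w; first by rewrite mem eqxx.
      by apply: contra wA; apply: (subsetP ZA).
    exists u, v; split=> //; move: vS; rewrite mem !inE.
    case/or3P=> [->//|->|vB]; first by rewrite orbT.
    by have := nAB u v (subsetP ZA u uZ) vB; rewrite uv.
  apply/connP => Z ZA Z0; have [wZ|wZ] := boolP (w \in Z); last first.
    apply: key => //; apply/subsetP => u uZ; have := subsetP (proper_sub ZA) u uZ.
    by rewrite !inE => /predU1P[e|//]; rewrite -e uZ in wZ.
  have [||u [v [uD vA vD uv]]] := key ((w |: A) :\: Z).
  - apply/subsetP => u; rewrite !inE => /andP[uZ /predU1P[e|//]].
    by rewrite e wZ in uZ.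
  - by rewrite setD_eq0; move: ZA; rewrite properE => /andP[].
  move: uD vD; rewrite !in_setD vA andbT negbK => /andP[uZ uA] vZ.
  by exists v, u; rewrite adj_sym.
exists X, Y; split=> //; first exact: half wX wY nXY memS.
apply: half wY wX _ _ => [u v uY vX|u]; first by rewrite adj_sym nXY.
by rewrite memS; congr (_ || _); rewrite orbC.
Qed.

Lemma cut_at_notin S w X Y : cut_at S w X Y -> w \notin X.
Proof.
by case=> /setP/(_ w) + _ _ _ _ _ _; rewrite !inE eqxx => /esym/norP[].
Qed.

Lemma cut_atD1 S w X Y : cut_at S w X Y -> (w |: X) :\ w = X.
Proof. by move=> /cut_at_notin wX; rewrite setU1K. Qed.

Lemma cut_at_card S w X Y : w \in S -> cut_at S w X Y ->
  #|S| = (#|X| + #|Y|).+1.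
Proof.
move=> wS [e _ _ d _ _ _]; rewrite (cardsD1 w) wS e cardsU.
by move: d; rewrite -setI_eq0 => /eqP->; rewrite cards0 subn0.
Qed.

Lemma cut_at_sub S w X Y : w \in S -> cut_at S w X Y -> w |: X \proper S.
Proof.
move=> wS h; have wX := cut_at_notin h; have cS := cut_at_card wS h.
case: h => e _ Y0 _ _ _ _; rewrite properEcard cardsU1 wX cS subUset sub1set wS.
have -> : X \subset S by apply: subset_trans (subD1set S w); rewrite e subsetUl.
by rewrite -card_gt0 in Y0; rewrite /=; lia.
Qed.

Lemma cut_at_ipD1 (K : comNzRingType) S w X Y (x : K) : cut_at S w X Y ->
  ip (S :\ w) x = ip X x * ip Y x.
Proof. by case=> -> _ _ d n _ _; rewrite ipU. Qed.

Lemma cut_at_ip_ndel (K : comNzRingType) S w X Y (x : K) : cut_at S w X Y ->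
  ip (ndel S w) x = ip (ndel (w |: X) w) x * ip (ndel (w |: Y) w) x.
Proof.
move=> h; have hX := cut_atD1 h; have hY := cut_atD1 (cut_at_sym h).
case: h => e _ _ d n _ _; rewrite -ipU.
- by congr ip; rewrite /ndel e hX hY; apply/setP => u; rewrite !inE andb_orl.
- have sX := ndel_sub (w |: X) w; have sY := ndel_sub (w |: Y) w.
  by rewrite hX in sX; rewrite hY in sY; apply: disjointWl sX (disjointWr sY d).
move=> u v /(subsetP (ndel_sub _ _)) uX /(subsetP (ndel_sub _ _)) vY.
by rewrite hX in uX; rewrite hY in vY; exact: n.
Qed.

End Connectivity.

(** * Upper bounds by paths and cycles *)

Section EdgeCount.
Variable G : graph.
Implicit Types (S X Y : {set G}) (u v w : G).

Definition deg S v := #|[set u in S | adj v u]|.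

Definition dsum S := (\sum_(v in S) deg S v)%N.

(** The number of induced edges by handshaking; [dsum_even] shows that halving loses nothing. *)
Definition ne S := (dsum S)./2.

Lemma degD1 S u v : v \in S -> deg S u = (adj u v + deg (S :\ v) u)%N.
Proof.
move=> vS; rewrite /deg (cardsD1 v) inE vS /=; congr (_ + _)%N.
by apply: eq_card => z; rewrite !inE andbA.
Qed.

Lemma degS S X v : X \subset S -> (deg X v <= deg S v)%N.
Proof.
move=> /subsetP XS; apply/subset_leq_card/subsetP => u; rewrite !inE.
by case/andP=> /XS-> ->.
Qed.

Lemma deg_le1P S v : reflect {in S &, forall a b, adj v a -> adj v b -> a = b} (deg S v <= 1)%N.
Proof.
apply: (iffP card_le1_eqP) => h a b.
  by move=> aS bS va vb; apply: h; rewrite inE ?aS ?bS.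
by rewrite !inE => /andP[aS va] /andP[bS vb]; exact: (h b a bS aS vb va).
Qed.

Lemma deg_gt1P S v : reflect (exists a b, [/\ a \in S, b \in S, a != b, adj v a & adj v b])
  (1 < deg S v)%N.
Proof.
apply: (iffP card_gt1P) => -[a [b]].
  by rewrite !inE => -[/andP[aS va] /andP[bS vb] ab]; exists a, b.
by case=> aS bS ab va vb; exists a, b; rewrite !inE aS bS.
Qed.

Lemma dsumD1 S v : v \in S -> dsum S = (dsum (S :\ v) + (deg S v).*2)%N.
Proof.
move=> vS; rewrite /dsum (big_setD1 v) //=.
rewrite (eq_bigr (fun u => adj u v + deg (S :\ v) u)%N) => [|u _]; last exact: degD1.
rewrite big_split /= addnA addnC -addnn; congr (_ + (_ + _))%N.
rewrite /deg -sum1_card (bigID (fun u => adj u v)) /= [X in (_ + X)%N]big1 ?addn0; last first.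
  by move=> u /andP[_ /negPf->].
apply: eq_big => [u|u /andP[_ ->] //]; rewrite !inE [adj u v]adj_sym.
by have [->|_] := eqVneq u v; rewrite ?adj_irrefl ?andbF.
Qed.

Lemma dsum_even S : dsum S = (ne S).*2.
Proof.
rewrite /ne -[LHS]odd_double_half; suff -> : odd (dsum S) = false by [].
elim/set_ind: S => S IH; have [->|[v vS]] := set_0Vmem S; first by rewrite /dsum big_set0.
by rewrite (dsumD1 vS) oddD odd_double addbF IH // properD1.
Qed.

Lemma neD1 S v : v \in S -> ne S = (ne (S :\ v) + deg S v)%N.
Proof. by move=> vS; have := dsumD1 vS; rewrite !dsum_even; lia. Qed.

Lemma ne0 : ne set0 = 0%N.
Proof. by rewrite /ne /dsum big_set0. Qed.

Lemma neU X Y : [disjoint X & Y] -> {in X & Y, forall u v, ~~ adj u v} ->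
  ne (X :|: Y) = (ne X + ne Y)%N.
Proof.
move=> d n; apply: double_inj; rewrite doubleD -!dsum_even /dsum.
rewrite (eq_bigl [predU X & Y]) => [|u]; last by rewrite !inE.
rewrite bigU //=; congr (_ + _)%N; apply: eq_bigr => u uZ; apply: eq_card => v; rewrite !inE.
  by have [uv|] := boolP (adj u v); rewrite ?andbF // !andbT orb_idr // => vY; have := n u v uZ vY; rewrite uv.
have [uv|] := boolP (adj u v); rewrite ?andbF // !andbT orb_idl // => vX.
by have := n v u vX uZ; rewrite adj_sym uv.
Qed.

(** Each edge lies in exactly one half, since the halves share only [w]. *)
Lemma cut_at_ne S w X Y : w \in S -> cut_at S w X Y ->
  ne S = (ne (w |: X) + ne (w |: Y))%N.
Proof.
move=> wS h; have hX := cut_atD1 h; have hY := cut_atD1 (cut_at_sym h).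
have [e _ _ d n _ _] := h.
rewrite (neD1 wS) (@neD1 (w |: X) w) ?setU11 // (@neD1 (w |: Y) w) ?setU11 //.
rewrite hX hY e neU // -addnACA; congr (_ + _)%N.
rewrite (degD1 w wS) (@degD1 (w |: X) w w) ?setU11 // (@degD1 (w |: Y) w w) ?setU11 //.
rewrite hX hY e adj_irrefl !add0n /deg -cardsUI [X in (_ + X)%N](_ : _ = 0%N) ?addn0.
  by apply: eq_card => u; rewrite !inE andb_orl.
apply/eqP; rewrite cards_eq0 -subset0; apply/subsetP => u; rewrite !inE.
by case/andP=> /andP[uX _] /andP[]; rewrite (disjointFr d uX).
Qed.

End EdgeCount.

(** * Bounds on deletion ratios at a negative point *)

Section RatioBounds.
Variables (F : realFieldType) (G : graph) (x : F).
Hypothesis x0 : x < 0.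
Implicit Types (S X Y K : {set G}) (u v w : G).

Let xle0 : x <= 0. Proof. exact: ltW. Qed.

(** Enlarging [ndel S v] to [X] lowers its value, and the negative factor [x] reverses the
    inequality. *)
Lemma ip_ndel_ge S v X : v \in S -> good S x -> ndel S v \subset X -> X \subset S ->
  ip S x <= ip (S :\ v) x + x * ip X x.
Proof.
move=> vS gS nX XS; rewrite (ip_del _ vS) lerD2l ler_wnM2l //.
by apply: ip_anti => //; apply: goodS gS.
Qed.

(** The hypotheses amount to [a' / a <= A1 / A0] and [b' / b <= B1 / B0]; these are multiplied
    together and then by [x < 0]. This joins the two halves at a cut vertex. *)
Lemma merge_ratio (A0 A1 B0 B1 a a' b b' : F) :
  0 < A0 -> 0 < A1 -> 0 < B0 -> 0 < B1 -> 0 < a -> 0 < b -> 0 <= a' -> 0 <= b' ->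
  (A0 + x * A1) * a <= (a + x * a') * A0 ->
  (B0 + x * B1) * b <= (b + x * b') * B0 ->
  (A0 * B0 + x * (A1 * B1)) * (a * b) <= (a * b + x * (a' * b')) * (A0 * B0).
Proof.
move=> A00 A10 B00 B10 a0 b0 a'0 b'0 hA hB.
have hA' : a' * A0 <= A1 * a by rewrite -(ler_nM2l x0); lra.
have hB' : b' * B0 <= B1 * b by rewrite -(ler_nM2l x0); lra.
have h : (a' * A0) * (b' * B0) <= (A1 * a) * (B1 * b).
  by apply: ler_pM => //; apply: mulr_ge0 => //; apply: ltW.
have := ler_wnM2l xle0 h.
have -> : (A0 * B0 + x * (A1 * B1)) * (a * b) =
  A0 * B0 * (a * b) + x * (A1 * a * (B1 * b)) by ring.
have -> : (a * b + x * (a' * b')) * (A0 * B0) =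
  A0 * B0 * (a * b) + x * (a' * A0 * (b' * B0)) by ring.
lra.
Qed.

Lemma cut_at_ip S w X Y : w \in S -> cut_at S w X Y ->
  ip S x = ip X x * ip Y x + x * (ip (ndel (w |: X) w) x * ip (ndel (w |: Y) w) x).
Proof.
by move=> wS h; rewrite (ip_del _ wS) (cut_at_ipD1 _ h) (cut_at_ip_ndel _ h).
Qed.

Lemma cut_at_half S w X Y : cut_at S w X Y ->
  ip (w |: X) x = ip X x + x * ip (ndel (w |: X) w) x.
Proof. by move=> h; rewrite (@ip_del _ _ _ w) ?setU11 // (cut_atD1 h). Qed.

(** At a non-cut [w], a neighbour [z] gives [ip K <= ip (K :\ w) + x * ip (K :\ w :\ z)], and
    induction applies to [z]. At a cut vertex the halves combine to the ratio of a path at an inner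
    vertex, which is at most its ratio at an end. *)
Lemma path_ratio K w : conn K -> w \in K -> good K x ->
  0 < qp x #|K|.+1 /\ ip K x * qp x #|K| <= qp x #|K|.+1 * ip (K :\ w) x.
Proof.
elim/set_ind: K w => K IH w cK wK gK.
(* Smaller indices are positive by induction on connected subsets of the right size. *)
have pos j : (j <= #|K|)%N -> 0 < qp x j.
  case: j => [|[|j]]; rewrite ?ltr01 // => jK.
  have [|S [SK cS cardS]] := @conn_sub _ K j.+1 cK; first by lia.
  have pS : S \proper K by rewrite properEcard SK cardS.
  have [v vS] : exists v, v \in S by apply/card_gt0P; rewrite cardS.
  by have [] := IH S pS v cS vS (goodS SK gK); rewrite cardS.
suff h : ip K x * qp x #|K| <= qp x #|K|.+1 * ip (K :\ w) x.
  split=> //; have gKw : 0 < ip (K :\ w) x by apply: gK; apply: subD1set.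
  rewrite -(pmulr_lgt0 _ gKw); apply: lt_le_trans h.
  by rewrite mulr_gt0 ?pos // gK.
have cK1 := cardsD1 w K; rewrite wK add1n in cK1.
have [cKw|[X [Y h]]] := conn_cut cK wK.
  have [Kw0|Kw0] := eqVneq (K :\ w) set0.
    rewrite cK1 Kw0 cards0 (ip_del _ wK) Kw0 ip0 /qp /=.
    have -> : ndel K w = set0 by apply/eqP; rewrite -subset0 -Kw0 ndel_sub.
    by rewrite ip0; lra.
  have [|z zK wz] := conn_neighbor cK wK; first by rewrite cK1 ltnS card_gt0.
  have [_ h] := IH _ (properD1 wK) z cKw zK (goodS (subD1set _ _) gK).
  have := @ip_ndel_ge K w ((K :\ w) :\ z) wK gK.
  rewrite subsetD1 ndel_sub inE wz andbF => /(_ isT) h2.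
  have := h2 (subset_trans (subD1set _ _) (subD1set _ _)) => {}h2.
  rewrite cK1 in pos *; have pn := pos _ (leqnn _).
  rewrite qpSS mulrDl; move: (ler_wpM2r (ltW pn) h2) => h3.
  move: (ler_wnM2l xle0 h); move: h3.
  set A := ip K x; set B := ip (K :\ w) x; set C := ip _ x.
  by lra.
have [e X0 Y0 d n cX cY] := h; have h' := cut_at_sym h.
have pX := cut_at_sub wK h; have pY := cut_at_sub wK h'.
have wX := cut_at_notin h; have wY := cut_at_notin h'.
have [_ hX] := IH _ pX w cX (setU11 _ _) (goodS (proper_sub pX) gK).
have [_ hY] := IH _ pY w cY (setU11 _ _) (goodS (proper_sub pY) gK).
have cardK := cut_at_card wK h.
rewrite !cardsU1 wX wY !add1n in hX hY.
rewrite (cut_at_half h) (cut_atD1 h) in hX; rewrite (cut_at_half h') (cut_atD1 h') in hY.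
have sX : X \subset K := subset_trans (subsetUr _ _) (proper_sub pX).
have sY : Y \subset K := subset_trans (subsetUr _ _) (proper_sub pY).
have nX := subset_trans (ndel_sub (w |: X) w) (subset_trans (subD1set _ _) (proper_sub pX)).
have nY := subset_trans (ndel_sub (w |: Y) w) (subset_trans (subD1set _ _) (proper_sub pY)).
have gK0 : 0 < ip K x by exact: gK.
have {gK} [gX gY gnX gnY] := And4 (gK _ sX) (gK _ sY) (gK _ nX) (gK _ nY).
have [i eX] : exists i, #|X| = i.+1 by exists #|X|.-1; rewrite prednK // card_gt0.
have [j eY] : exists j, #|Y| = j.+1 by exists #|Y|.-1; rewrite prednK // card_gt0.
rewrite eX in hX; rewrite eY in hY; rewrite eX eY addSn addnS in cardK.
have posX k : (k <= i.+2)%N -> 0 < qp x k by move=> hk; apply: pos; rewrite cardK; move: hk; clear; lia.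
have posY k : (k <= j.+2)%N -> 0 < qp x k by move=> hk; apply: pos; rewrite cardK; move: hk; clear; lia.
rewrite [qp x i.+3]qpSS in hX; rewrite [qp x j.+3]qpSS in hY.
have := merge_ratio gX gnX gY gnY (posX _ (leqnn _)) (posY _ (leqnn _))
  (ltW (posX _ (leqnSn _))) (ltW (posY _ (leqnSn _))) hX hY.
rewrite -(cut_at_ip wK h) -(cut_at_ipD1 _ h).
have -> : qp x i.+2 * qp x j.+2 + x * (qp x i.+1 * qp x j.+1) = qp x #|K|.+1.
  by rewrite mulrA cardK -addnS -addSn [RHS]lrec_add.
apply: le_trans; rewrite cardK ler_wpM2l ?(ltW gK0) //.
rewrite -addSn; apply: (lrec_add_le x0) _ (ltW (posY _ _)) => //; last by clear; lia.
by apply: (@qp_anti _ x x0 i.+1) => k hk; apply: posX; move: hk; clear; lia.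
Qed.

Lemma qp_pos K j : conn K -> good K x -> (j <= #|K|.+1)%N -> 0 < qp x j.
Proof.
case: j => [|[|j]] cK gK; rewrite ?ltr01 // ltnS => jK.
have [|S [SK cS cardS]] := @conn_sub _ K j.+1 cK; first by lia.
have [v vS] : exists v, v \in S by apply/card_gt0P; rewrite cardS.
by have [] := path_ratio cS vS (goodS SK gK); rewrite cardS.
Qed.

(** The extremal case is a path losing both ends. If [v] is not a cut vertex, two instances of
    [path_ratio] are chained; otherwise induction runs in the half containing [w]. *)
Lemma path_ratio2 K v w : conn K -> v \in K -> w \in K -> v != w -> good K x ->
  ip K x * qp x #|K|.-1 <= qp x #|K|.+1 * ip (K :\ v :\ w) x.
Proof.
elim/set_ind: K v w => K IH v w cK vK wK vw gK.
have cK1 := cardsD1 v K; rewrite vK add1n in cK1.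
have wKv : w \in K :\ v by rewrite !inE eq_sym vw.
have pos := qp_pos cK gK.
have [cKv|[X [Y h]]] := conn_cut cK vK.
  have [_ h1] := path_ratio cK vK gK.
  have [_ h2] := path_ratio cKv wKv (goodS (subD1set _ _) gK).
  rewrite cK1 /= in pos h1 *; have pn := pos _ (leqnSn _).
  rewrite -(ler_pM2r pn).
  have p0 := ltW (pos _ (ltnW (leqnSn _))); have p2 := ltW (pos _ (leqnn _)).
  have := ler_wpM2r p0 h1; have := ler_wpM2l p2 h2.
  by lra.
wlog wY : X Y h / w \in Y.
  move=> hyp; have [e _ _ _ _ _ _] := h; have : w \in X :|: Y by rewrite -e.
  case/setUP=> [wX|].
    exact: (hyp Y X (cut_at_sym h)).
  exact: (hyp X Y).
have [e X0 Y0 d n cX cY] := h; have h' := cut_at_sym h.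
have pX := cut_at_sub vK h; have pY := cut_at_sub vK h'.
have vX := cut_at_notin h; have vY := cut_at_notin h'.
have [_ hX] := path_ratio cX (setU11 _ _) (goodS (proper_sub pX) gK).
have [_ hY] := path_ratio cY (setU11 _ _) (goodS (proper_sub pY) gK).
have hR := IH _ pY v w cY (setU11 _ _) (setU1r _ wY) vw (goodS (proper_sub pY) gK).
have cardK := cut_at_card vK h.
rewrite !cardsU1 vX vY !add1n in hX hY hR.
rewrite (cut_at_half h) (cut_atD1 h) in hX.
rewrite (cut_at_half h') (cut_atD1 h') in hY hR.
have -> : ip (K :\ v :\ w) x = ip X x * ip (Y :\ w) x.
  rewrite e -ipU.
  - congr ip; apply/setP => u; rewrite !inE; have [->|//] := eqVneq u w.
    by rewrite (disjointFl d wY).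
  - exact: disjointWr (subD1set _ _) d.
  by move=> u z uX /(subsetP (subD1set _ _)) zY; exact: n.
have gK0 : 0 < ip K x by exact: gK.
have sX : X \subset K := subset_trans (subsetUr _ _) (proper_sub pX).
have sY : Y \subset K := subset_trans (subsetUr _ _) (proper_sub pY).
have nX := subset_trans (ndel_sub (v |: X) v) (subset_trans (subD1set _ _) (proper_sub pX)).
have nY := subset_trans (ndel_sub (v |: Y) v) (subset_trans (subD1set _ _) (proper_sub pY)).
have {gK} [gX gY gnX gnY gD] := And5 (gK _ sX) (gK _ sY) (gK _ nX) (gK _ nY)
  (gK _ (subset_trans (subD1set _ w) sY)).
have [i eX] : exists i, #|X| = i.+1 by exists #|X|.-1; rewrite prednK // card_gt0.
have [j eY] : exists j, #|Y| = j.+1 by exists #|Y|.-1; rewrite prednK // card_gt0.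
rewrite eX in hX; rewrite eY in hY hR; rewrite eX eY addSn addnS in cardK.
have posX k : (k <= i.+3)%N -> 0 < qp x k by move=> hk; apply: pos; rewrite cardK; move: hk; clear; lia.
have posY k : (k <= j.+3)%N -> 0 < qp x k by move=> hk; apply: pos; rewrite cardK; move: hk; clear; lia.
rewrite (cut_at_ip vK h) cardK /= in gK0 *.
have split_q : qp x (i + j).+4 = qp x i.+2 * qp x j.+2 + x * qp x i.+1 * qp x j.+1.
  by rewrite -addnS -addSn [LHS]lrec_add.
have le_q : qp x (i + j).+2 <= qp x i.+2 * qp x j.+1.
  rewrite addnC mulrC; apply: (lrec_add_le x0) _ (ltW (posX _ _)) => //; last by clear; lia.
  by apply: (@qp_anti _ x x0 j) => k hk; apply: posY; move: hk; clear; lia.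
move: hX hY hR gX gnX gY gnY gD gK0.
set A0 := ip X x; set A1 := ip (ndel (v |: X) v) x; set B0 := ip Y x.
set B1 := ip (ndel (v |: Y) v) x; set D := ip (Y :\ w) x.
move=> hX hY hR A00 A10 B00 B10 D0 gK0.
have [qi qi1 qi2] := And3 (posX i (ltnW (ltnW (leqnSn _)))) (posX i.+1 (ltnW (leqnSn _))) (posX i.+2 (leqnSn _)).
have [qj1 qj2 qj3] := And3 (posY j.+1 (ltnW (leqnSn _))) (posY j.+2 (leqnSn _)) (posY j.+3 (leqnn _)).
rewrite [qp x i.+3]qpSS in hX.
have hA : qp x i.+1 * A0 <= A1 * qp x i.+2 by rewrite -(ler_nM2l x0); lra.
have hB : qp x j.+1 * B0 <= B1 * qp x j.+2.
  by rewrite -(ler_nM2l x0); move: hY; rewrite [qp x j.+3]qpSS; lra.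
(* [E] is the value of [v |: Y] with a path on [i + 1] vertices attached to [v] by an end, in place
   of [X]. *)
set E := qp x i.+2 * B0 + x * qp x i.+1 * B1.
have step1 : (A0 * B0 + x * (A1 * B1)) * qp x i.+2 <= A0 * E.
  have := ler_wnM2l xle0 (ler_wpM2r (ltW B10) hA); rewrite /E; lra.
(* The difference factors as [x * x * qp x i] times the nonnegative difference of [hB]. *)
have step2 : E * qp x j.+3 <= qp x (i + j).+4 * (B0 + x * B1).
  rewrite split_q -subr_ge0 /E [qp x j.+3]qpSS.
  rewrite [X in 0 <= X](_ : _ = x * (qp x i.+2 - qp x i.+1) *
    (B1 * qp x j.+2 - qp x j.+1 * B0)); last by ring.
  rewrite [qp x i.+2]qpSS addrAC subrr add0r mulrA.
  by rewrite mulr_ge0 ?subr_ge0 // mulr_ge0 ?ltW // nmulr_rgt0.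
have step3 : E * qp x j.+1 <= qp x (i + j).+4 * D.
  rewrite -(ler_pM2r qj3).
  have q4 : 0 <= qp x (i + j).+4 by apply/ltW/pos; rewrite cardK.
  by have := ler_wpM2r (ltW qj1) step2; have := ler_wpM2l q4 hR; lra.
have E0 : 0 < A0 * E by apply: lt_le_trans step1; rewrite mulr_gt0.
rewrite -(ler_pM2r qi2).
apply: (@le_trans _ _ (A0 * E * (qp x i.+2 * qp x j.+1))).
  rewrite mulrAC; apply: ler_pM => //; first by rewrite mulr_ge0 // ltW.
  by apply/ltW/pos; rewrite cardK; clear; lia.
by have := ler_wpM2l (ltW (mulr_gt0 A00 qi2)) step3; lra.
Qed.

(** Removing non-cut vertices one at a time telescopes the ratios of [path_ratio]. *)
Lemma ip_le_path K : conn K -> good K x -> ip K x <= qp x #|K|.+1.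
Proof.
elim/set_ind: K => K IH cK gK; have pos := qp_pos cK gK.
have [|K1] := leqP #|K| 0.
  by rewrite leqn0 cards_eq0 => /eqP->; rewrite ip0 cards0.
have [w wK cKw] : exists2 w, w \in K & conn (K :\ w).
  have [K2|K2] := leqP #|K| 1; last exact: conn_noncut.
  have [w eK] : exists w, K = [set w] by apply/cards1P; rewrite eqn_leq K2.
  exists w; first by rewrite eK set11.
  by rewrite eK setDv; apply/connP => X; rewrite properE subset0 => /andP[/eqP->]; rewrite sub0set.
have [_ h] := path_ratio cK wK gK.
have h2 := IH _ (properD1 wK) cKw (goodS (subD1set _ _) gK).
have e := cardsD1 w K; rewrite wK add1n in e.
rewrite -(ler_pM2r (pos _ (leqnSn _))); apply: le_trans h _.
by rewrite -e in h2; rewrite ler_wpM2l // ltW // pos.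
Qed.

Lemma deg_conn_le1 K w : w \in K -> (deg K w <= 1)%N -> (#|K| <= ne K)%N ->
  K :\ w != set0 /\ (#|K :\ w| <= ne (K :\ w))%N.
Proof.
move=> wK dw; have := cardsD1 w K; rewrite wK (neD1 wK) => -> eK.
split; last by lia.
apply: contraTneq eK => Kw0.
rewrite (degD1 w wK) adj_irrefl Kw0 ne0 cards0 /deg (_ : [set _ in _ | _] = set0) ?cards0 //.
by apply/setP => u; rewrite !inE.
Qed.

(** Two neighbours [a], [b] of [w] are missing from [ndel K w]; [path_ratio2] for [a], [b] in
    [K :\ w] then reproduces [cpE], as if [w] closed a path into a cycle. *)
Lemma cycle_closing K w : w \in K -> conn (K :\ w) -> (1 < deg K w)%N ->
  good K x -> (2 < #|K|)%N /\ ip K x * qp x #|K| <= cp x #|K| * ip (K :\ w) x.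
Proof.
move=> wK cKw /deg_gt1P[a [b [aK bK ab wa wb]]] gK.
have gKw := goodS (subD1set K w) gK.
have aKw : a \in K :\ w by rewrite !inE aK andbT; apply: contraTneq wa => ->; rewrite adj_irrefl.
have bKw : b \in K :\ w by rewrite !inE bK andbT; apply: contraTneq wb => ->; rewrite adj_irrefl.
have h := path_ratio2 cKw aKw bKw ab gKw.
have cK : #|K| = (#|K :\ w :\ a :\ b|).+3.
  rewrite (cardsD1 w) wK (cardsD1 a) aKw (cardsD1 b (K :\ w :\ a)).
  by rewrite (in_setD1 b _ a) eq_sym ab bKw.
have cKw' : #|K :\ w| = (#|K :\ w :\ a :\ b|).+2.
  by move: cK; rewrite (cardsD1 w) wK => -[].
have pos := qp_pos cKw gKw; rewrite cKw' in h pos; rewrite cK; split=> //.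
set k := #|_ :\ b| in h pos *.
have sD : K :\ w :\ a :\ b \subset K.
  by apply: subset_trans (subD1set _ _) _; apply: subset_trans (subD1set _ _) (subD1set _ _).
have := @ip_ndel_ge K w (K :\ w :\ a :\ b) wK gK; rewrite sD.
have -> : ndel K w \subset K :\ w :\ a :\ b.
  by rewrite 2!subsetD1 ndel_sub !inE wa wb !andbF.
move=> /(_ isT isT) h2; rewrite cpE.
have pk := pos k.+3 (leqnn _).
have := ler_wpM2r (ltW pk) h2; have := ler_wnM2l xle0 h.
by rewrite [k.+2.-1]/=; lra.
Qed.

(** The scheme of [path_ratio], with [cycle_closing] when [w] is a non-cut vertex of degree at least
    2. At a cut vertex one half is compared with a cycle and the other with a path. *)
Lemma cycle_ratio K w : conn K -> (#|K| <= ne K)%N -> w \in K -> good K x ->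
  0 < cp x #|K| /\ ip K x * cp x #|K|.-1 <= cp x #|K| * ip (K :\ w) x.
Proof.
elim/set_ind: K w => K IH w cK eK wK gK; have pos := qp_pos cK gK.
have cK1 := cardsD1 w K; rewrite wK add1n in cK1.
have gK0 : 0 < ip K x by apply: gK.
have gKw : 0 < ip (K :\ w) x by apply: gK; apply: subD1set.
have [cKw|[X [Y h]]] := conn_cut cK wK.
  have [dw|dw] := leqP (deg K w) 1.
    have [Kw0 eKw] := deg_conn_le1 wK dw eK.
    have [|z zK wz] := conn_neighbor cK wK; first by rewrite cK1 ltnS card_gt0.
    have [c0 h] := IH _ (properD1 wK) z cKw eKw zK (goodS (subD1set _ _) gK).
    have := @ip_ndel_ge K w ((K :\ w) :\ z) wK gK.
    rewrite subsetD1 ndel_sub inE wz andbF => /(_ isT) h2.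
    have := h2 (subset_trans (subD1set _ _) (subD1set _ _)) => {}h2.
    have [m em] : exists m, #|K :\ w| = m.+1.
      by exists #|K :\ w|.-1; rewrite prednK // card_gt0.
    rewrite cK1 em cpSS /=; rewrite em /= in c0 h.
    have h3 : ip K x * cp x m.+1 <= (cp x m.+1 + x * cp x m) * ip (K :\ w) x.
      by have := ler_wpM2r (ltW c0) h2; have := ler_wnM2l xle0 h; lra.
    split=> //; rewrite -(pmulr_lgt0 _ gKw); apply: lt_le_trans h3.
    by rewrite mulr_gt0.
  have [K3 h] := cycle_closing wK cKw dw gK.
  have h3 : ip K x * cp x #|K|.-1 <= cp x #|K| * ip (K :\ w) x.
    (* Since [cp x k.+2 <= qp x k.+3], the bound from [cycle_closing] is the stronger one. *)
    apply: le_trans h; rewrite ler_pM2l //; case: #|K| K3 pos => [|[|[|k]]] // _ pos.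
    rewrite [k.+3.-1]/= cpE [qp x k.+3]qpSS lerD2l ler_wnM2l //.
    by apply: (@qp_anti _ x x0 k) => i hi; apply: pos; apply: leq_trans hi _; clear; lia.
  split=> //; rewrite -(pmulr_lgt0 _ gKw); apply: lt_le_trans h.
  by rewrite mulr_gt0 // pos.
(* The halves have [#|K| + 1] vertices and at least [#|K|] edges in total, so one of them has at
   least as many edges as vertices. *)
wlog eX : X Y h / (#|w |: X| <= ne (w |: X))%N.
  move=> hyp; have [eX|eX] := leqP #|w |: X| (ne (w |: X)); first exact: (hyp X Y).
  apply: (hyp Y X (cut_at_sym h)); move: eK eX.
  rewrite (cut_at_ne wK h) (cut_at_card wK h) !cardsU1 (cut_at_notin h).
  by rewrite (cut_at_notin (cut_at_sym h)); lia.
have [e X0 Y0 d n cX cY] := h; have h' := cut_at_sym h.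
have pX := cut_at_sub wK h; have pY := cut_at_sub wK h'.
have wX := cut_at_notin h; have wY := cut_at_notin h'.
have [c0 hX] := IH _ pX w cX eX (setU11 _ _) (goodS (proper_sub pX) gK).
have [_ hY] := path_ratio cY (setU11 _ _) (goodS (proper_sub pY) gK).
have cardK := cut_at_card wK h.
rewrite !cardsU1 wX wY !add1n in c0 hX hY.
rewrite (cut_at_half h) (cut_atD1 h) in hX; rewrite (cut_at_half h') (cut_atD1 h') in hY.
have sX : X \subset K := subset_trans (subsetUr _ _) (proper_sub pX).
have sY : Y \subset K := subset_trans (subsetUr _ _) (proper_sub pY).
have nX := subset_trans (ndel_sub (w |: X) w) (subset_trans (subD1set _ _) (proper_sub pX)).
have nY := subset_trans (ndel_sub (w |: Y) w) (subset_trans (subD1set _ _) (proper_sub pY)).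
have {gK} [gX gY gnX gnY] := And4 (gK _ sX) (gK _ sY) (gK _ nX) (gK _ nY).
have [i ci] : exists i, #|X| = i.+1 by exists #|X|.-1; rewrite prednK // card_gt0.
have [j cj] : exists j, #|Y| = j.+1 by exists #|Y|.-1; rewrite prednK // card_gt0.
rewrite ci /= in c0 hX; rewrite cj in hY; rewrite ci cj addSn addnS in cardK.
have posX : forall k, (k <= i.+2)%N -> 0 < cp x k.
  apply: cp_pos_down => // k hk.
  by apply: pos; rewrite cardK; move: hk; clear; lia.
have posY k : (k <= j.+2)%N -> 0 < qp x k.
  by move=> hk; apply: pos; rewrite cardK; move: hk; clear; lia.
rewrite [cp x i.+2]cpSS in hX; rewrite [qp x j.+3]qpSS in hY.
have := merge_ratio gX gnX gY gnY (posX _ (leqnSn _)) (posY _ (leqnn _))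
  (ltW (posX _ (ltnW (leqnSn _)))) (ltW (posY _ (leqnSn _))) hX hY.
rewrite -(cut_at_ip wK h) -(cut_at_ipD1 _ h).
have -> : cp x i.+1 * qp x j.+2 + x * (cp x i * qp x j.+1) = cp x #|K|.
  by rewrite mulrA cardK -addnS [RHS]lrec_add.
move=> h3; have p1 : 0 < cp x i.+1 * qp x j.+2.
  by rewrite mulr_gt0 ?posX ?posY.
split.
  rewrite -(pmulr_lgt0 _ gKw); apply: lt_le_trans h3.
  by rewrite mulr_gt0.
apply: le_trans h3; rewrite cardK /= ler_wpM2l ?(ltW gK0) //.
apply: (lrec_add_le x0) _ (ltW (posY _ _)) => //; last by clear; lia.
by apply: (@cp_anti _ x x0 i) => k hk; apply: posX; move: hk; clear; lia.
Qed.

(** Leaves that are not cut vertices are removed by induction; at a non-cut vertex of larger degree,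
    [cycle_closing] meets the path bound for the rest. *)
Lemma ip_le_cycle K : conn K -> (#|K| <= ne K)%N -> good K x -> ip K x <= cp x #|K|.
Proof.
elim/set_ind: K => K IH cK eK gK.
have [->|K0] := eqVneq K set0; first by rewrite ip0 cards0 /cp /=; lra.
have [K1|K1] := leqP #|K| 1.
  have [w eKw] : exists w, K = [set w].
    by apply/cards1P; rewrite eqn_leq K1 card_gt0.
  have wK : w \in K by rewrite eKw set11.
  have [|//] := deg_conn_le1 wK _ eK; last by rewrite eKw setDv eqxx.
  by apply: leq_trans K1; apply/subset_leq_card/subsetP => u; rewrite inE => /andP[].
have [w wK cKw] := conn_noncut cK K1; have gKw := goodS (subD1set K w) gK.
have cK1 := cardsD1 w K; rewrite wK add1n in cK1.
have [c0 hK] := cycle_ratio cK eK wK gK.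
have [dw|dw] := leqP (deg K w) 1.
  have [Kw0 eKw] := deg_conn_le1 wK dw eK.
  have h := IH _ (properD1 wK) cKw eKw gKw.
  have [z zK] := set0Pn _ Kw0.
  have [c1 _] := cycle_ratio cKw eKw zK gKw.
  rewrite -(ler_pM2r c1); rewrite cK1 /= in hK c0 *; apply: le_trans hK _.
  by rewrite ler_pM2l.
have [K3 h] := cycle_closing wK cKw dw gK.
have q0 := qp_pos cK gK (leqnSn _); rewrite -(ler_pM2r q0).
by apply: le_trans h _; rewrite ler_pM2l // cK1 ip_le_path.
Qed.

End RatioBounds.

(** * Lower bounds by stars and their unicyclic analogues *)

Section LowerBounds.
Variables (R : rcfType) (G : graph).
Implicit Types (S X Y K : {set G}) (u v w : G) (x y : R).

Lemma ip_set2 (F : comNzRingType) (a b : G) (x : F) : adj a b -> ip [set a; b] x = 1 + 2%:R * x :> F.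
Proof.
move=> ab; have neab : a != b by apply: contraTneq ab => ->; rewrite adj_irrefl.
have ip1 v : ip [set v] x = 1 + x.
  rewrite (@ip_del _ _ _ v) ?set11 // setDv ip0.
  have -> : ndel [set v] v = set0 by apply/eqP; rewrite -subset0 -(setDv [set v]) ndel_sub.
  by rewrite ip0 mulr1.
rewrite (@ip_del _ _ _ a) ?set21 // setU1K ?inE // ip1.
have -> : ndel [set a; b] a = set0.
  apply/setP => u; rewrite !inE; have [->|] := eqVneq u a => //= _.
  by have [->|//] := eqVneq u b; rewrite ab.
rewrite ip0; ring.
Qed.

(** Each vertex outside [X] costs a factor at most [1 + x], its value when isolated, because
    [ip (ndel S v) >= ip (S :\ v)]. *)
Lemma ip_le_sub S X x : x <= 0 -> -1 <= x -> good S x -> X \subset S ->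
  ip S x <= (1 + x) ^+ #|S :\: X| * ip X x.
Proof.
move=> x0 x1; elim/set_ind: S X => S IH X gS XS.
have [->|neXS] := eqVneq X S; first by rewrite setDv cards0 mul1r.
have /properP[_ [v vS vX]] : X \proper S by rewrite properEneq neXS.
have -> : #|S :\: X| = #|(S :\ v) :\: X|.+1.
  rewrite (cardsD1 v (S :\: X)) inE vS vX add1n; congr _.+1.
  by apply: eq_card => u; rewrite !inE andbCA.
have gSv := goodS (subD1set S v) gS.
have h : ip S x <= (1 + x) * ip (S :\ v) x.
  rewrite (ip_del _ vS) mulrDl mul1r lerD2l ler_wnM2l //.
  by apply: ip_anti => //; exact: ndel_sub.
apply: le_trans h _; rewrite exprS -mulrA ler_wpM2l //; first by lra.
by apply: IH => //; [exact: properD1 | rewrite subsetD1 XS].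
Qed.

Lemma card_ndel S v : v \in S -> (#|ndel S v| + deg S v)%N = #|S :\ v|.
Proof.
move=> vS; rewrite -(cardsID [set u | ~~ adj v u] (S :\ v)); congr (_ + _)%N.
  by apply: eq_card => u; rewrite !inE.
apply: eq_card => u; rewrite !inE negbK.
by have [->|] := eqVneq u v; rewrite ?adj_irrefl ?andbF // andbC.
Qed.

Lemma ndel_leaf S v w : w \in S -> adj v w -> (deg S v <= 1)%N -> ndel S v = S :\ v :\ w.
Proof.
move=> wS vw /deg_le1P d1; apply/setP => u; rewrite !inE.
have [->|uv] := eqVneq u v; rewrite /= ?andbF // andbC.
have [uS|] := boolP (u \in S); rewrite ?andbF //= !andbT.
have [->|uw] := eqVneq u w; first by rewrite vw.
by apply/negP => vu; rewrite (d1 u w) ?eqxx in uw.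
Qed.

Lemma conn_del_leaf S v : conn S -> v \in S -> (deg S v <= 1)%N -> conn (S :\ v).
Proof.
move=> cS vS /deg_le1P d1; have [//|[X [Y h]]] := conn_cut cS vS.
have [e X0 Y0 d n cX cY] := h; have h' := cut_at_sym h.
have nb (Z : {set G}) : v \notin Z -> Z != set0 -> conn (v |: Z) -> exists2 z, z \in Z & adj v z.
  move=> vZ Z0 cZ; have [|z zZ vz] := conn_neighbor cZ (setU11 _ _).
    by rewrite cardsU1 vZ ltnS card_gt0.
  by exists z => //; rewrite setU1K in zZ.
have [a aX va] := nb X (cut_at_notin h) X0 cX.
have [b bY vb] := nb Y (cut_at_notin h') Y0 cY.
have inS u : u \in X :|: Y -> u \in S by rewrite -e !inE => /andP[].
have := d1 a b; rewrite !inS ?inE ?aX ?bY ?orbT // => /(_ isT isT va vb) eab.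
by move: bY; rewrite -eab (disjointFr d aX).
Qed.

(* Equivalently, [S] induces a forest. *)
Definition one_degenerate S :=
  forall Y, Y \subset S -> Y != set0 -> exists2 v, v \in Y & (deg Y v <= 1)%N.

Lemma one_degenerateS S X : X \subset S -> one_degenerate S -> one_degenerate X.
Proof. by move=> XS h Y YX; apply: h; apply: subset_trans XS. Qed.

Lemma expr_mono k x y : -1 <= x -> x <= y -> (1 + x) ^+ k <= (1 + y) ^+ k.
Proof. by move=> x1 xy; rewrite lerXn2r ?nnegrE //; lra. Qed.

(** [(1 + x) ^+ k + x] belongs to the star with [k] leaves. Removing a leaf [u] at [w] leaves the
    term of [S :\ u :\ w], bounded by independent vertices; a star attains this. *)
Lemma forest_ip_ge S k x : one_degenerate S -> #|S| = k.+1 -> -1 < x <= 0 ->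
  0 < (1 + x) ^+ k + x -> (1 + x) ^+ k + x <= ip S x.
Proof.
elim: k S x => [|k IH] S x dS cardS /andP[x1 x0] pos.
  move/eqP/cards1P: cardS => [v ->].
  rewrite (@ip_del _ _ _ v) ?set11 // setDv ip0.
  have -> : ndel [set v] v = set0 by apply/eqP; rewrite -subset0 -(setDv [set v]) ndel_sub.
  by rewrite ip0 mulr1.
have [|u uS du] := dS S (subxx _); first by rewrite -card_gt0 cardS.
have card' : #|S :\ u| = k.+1 by have := cardsD1 u S; rewrite uS cardS => -[].
have dS' := one_degenerateS (subD1set S u) dS.
(* The induction hypothesis is needed on all of [[x, 0]], since [pos_good] asks for positivity along
   the interval. *)
have low y : x <= y <= 0 -> (1 + x) ^+ k.+1 + x <= (1 + y) ^+ k + y.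
  move=> /andP[xy y0]; rewrite lerD // exprS.
  have h1 := expr_mono k (ltW x1) xy.
  have h0 : 0 <= (1 + x) ^+ k by rewrite exprn_ge0 //; lra.
  by apply: le_trans h1; rewrite ler_piMl //; lra.
have IH' y : x <= y <= 0 -> (1 + y) ^+ k + y <= ip (S :\ u) y.
  move=> xy; apply: IH => //; last exact: lt_le_trans (low y xy).
  by case/andP: xy => xy ->; rewrite (lt_le_trans x1 xy).
have gS' : good (S :\ u) x.
  apply: pos_good => // y xy; apply: lt_le_trans (IH' y xy).
  exact: lt_le_trans (low y xy).
have := IH' x; rewrite lexx x0 => /(_ isT) hx.
have p0 : 0 <= (1 + x) ^+ k by rewrite exprn_ge0 //; lra.
rewrite (ip_del _ uS) exprS; have [/eqP|] := posnP (deg S u).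
  have := card_ndel uS; move=> + /eqP d0; rewrite d0 addn0 => cE.
  have -> : ndel S u = S :\ u by apply/eqP; rewrite eqEcard ndel_sub cE /=.
  have : 0 <= x * x by rewrite -expr2 sqr_ge0.
  have : (1 + x) * ((1 + x) ^+ k + x) <= (1 + x) * ip (S :\ u) x by rewrite ler_wpM2l //; lra.
  by lra.
case/card_gt0P=> w; rewrite inE => /andP[wS uw].
have wS' : w \in S :\ u by rewrite !inE wS andbT; apply: contraTneq uw => ->; rewrite adj_irrefl.
rewrite (ndel_leaf wS uw du).
have := @ip_le_sub (S :\ u :\ w) set0 x x0 (ltW x1) (goodS (subD1set _ _) gS') (sub0set _).
rewrite setD0 ip0 mulr1; have -> : #|S :\ u :\ w| = k.
  by have := cardsD1 w (S :\ u); rewrite wS' card' => -[].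
by move=> /(ler_wnM2l x0); lra.
Qed.

Lemma regular2 S : (forall v, v \in S -> (1 < deg S v)%N) -> ne S = #|S| ->
  forall v, v \in S -> deg S v = 2%N.
Proof.
move=> h e v vS; have := dsum_even S; rewrite e /dsum (big_setD1 v) //=.
have : ((\sum_(u in S :\ v) 2) <= \sum_(u in S :\ v) deg S u)%N.
  by apply: leq_sum => u; rewrite inE => /andP[_]; exact: h.
rewrite sum_nat_const (cardsD1 v S) vS; have := h v vS.
by move: (deg S v) (#|S :\ v|) (\sum_(_ in _) _)%N => a b c; lia.
Qed.

Lemma ne_gt0 S : (0 < ne S)%N -> exists a b, [/\ a \in S, b \in S & adj a b].
Proof.
move=> nS; have : (0 < dsum S)%N by rewrite dsum_even double_gt0.
rewrite /dsum lt0n sum_nat_eq0 negb_forall => /existsP[a].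
rewrite negb_imply -lt0n => /andP[aS /card_gt0P[b]]; rewrite inE => /andP[bS ab].
by exists a, b.
Qed.

(* The value of [I(U_n, x)] with [n = k + 3]. *)
Definition up (k : nat) (x : R) := (1 + x) ^+ k * (1 + 2%:R * x) + x.

Lemma up_mono k x y : -1 <= 2%:R * x -> x <= y -> up k x <= up k y.
Proof.
move=> x1 xy; rewrite /up lerD //; apply: ler_pM; try lra.
  by rewrite exprn_ge0 //; lra.
by apply: expr_mono; lra.
Qed.

Lemma upS k x : up k.+1 x = up k x + x * ((1 + x) ^+ k * (1 + 2%:R * x)).
Proof. by rewrite /up exprS; ring. Qed.

(** A leaf [u] at [w] is removed by induction, and an edge inside [S :\ u :\ w] bounds the other
    term by the increment in [upS]. Without leaves the graph is 2-regular, and deleting a vertex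
    leaves a forest. *)
Lemma unicyclic_ip_ge S k x : conn S -> ne S = #|S| -> #|S| = k.+3 ->
  -1 < 2%:R * x -> x <= 0 -> 0 < up k x -> up k x <= ip S x.
Proof.
elim/set_ind: S k x => S IH k x cS eS cardS x1 x0 pos.
have xN1 : -1 < x by lra.
have p0 i y : x <= y -> 0 <= (1 + y) ^+ i by move=> xy; rewrite exprn_ge0 //; lra.
have card' v : v \in S -> #|S :\ v| = k.+2.
  by move=> vS; have := cardsD1 v S; rewrite vS cardS => -[].
have [/exists_inP[u uS du]|nleaf] := boolP [exists u in S, (deg S u <= 1)%N].
  have cS' := conn_del_leaf cS uS du.
  have [|w wS' uw] := conn_neighbor cS uS; first by rewrite cardS.
  have [_ wS] := setD1P wS'.
  have du1 : deg S u = 1%N.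
    by apply/eqP; rewrite eqn_leq du; apply/card_gt0P; exists w; rewrite inE wS.
  have eS' : ne (S :\ u) = #|S :\ u|.
    by move: eS; rewrite (neD1 uS) du1 cardS card' //; lia.
  have dw : (deg (S :\ u) w <= k.+1)%N.
    have := card_ndel wS'; have := cardsD1 w (S :\ u); rewrite wS' card' // add1n.
    by move=> [->] <-; rewrite leq_addl.
  (* [S :\ u] has [k + 2] edges and [w] meets at most [k + 1] of them, so some edge avoids [w]. *)
  have [|a [b [aD bD ab]]] := @ne_gt0 (S :\ u :\ w).
    by move: eS'; rewrite (neD1 wS') card' //; lia.
  have sub2 : [set a; b] \subset S :\ u :\ w by rewrite subUset !sub1set aD.
  have card2 : #|[set a; b]| = 2%N.
    by rewrite cards2 (_ : a != b) //; apply: contraTneq ab => ->; rewrite adj_irrefl.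
  have cardD : #|S :\ u :\ w| = k.+1.
    by have := cardsD1 w (S :\ u); rewrite wS' card' // => -[].
  have := subset_leq_card sub2; rewrite card2 cardD ltnS => k1.
  case: k k1 cardS cardD card' dw pos => // k _ cardS cardD card' dw pos.
  have low y : x <= y <= 0 -> up k.+1 x <= up k y.
    move=> /andP[xy y0]; apply: le_trans (up_mono k _ xy); last by lra.
    by rewrite upS gerDl mulr_le0_ge0 // mulr_ge0 ?p0 //; lra.
  have IH' y : x <= y <= 0 -> up k y <= ip (S :\ u) y.
    move=> xy; apply: IH => //; first exact: properD1.
    - exact: card'.
    - by case/andP: xy => xy _; lra.
    - by case/andP: xy.
    exact: lt_le_trans (low y xy).
  have gS' : good (S :\ u) x.
    apply: pos_good => // y xy; apply: lt_le_trans (IH' y xy).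
    exact: lt_le_trans (low y xy).
  have := IH' x; rewrite lexx x0 => /(_ isT) hx.
  rewrite (ip_del _ uS) (ndel_leaf wS uw du) upS lerD // ler_wnM2l //.
  have := @ip_le_sub (S :\ u :\ w) [set a; b] x x0 (ltW xN1) (goodS (subD1set _ _) gS') sub2.
  by rewrite ip_set2 // cardsD (setIidPr sub2) card2 cardD subn2.
have deg2 v : v \in S -> deg S v = 2%N.
  apply: regular2 => // u uS; rewrite ltnNge; apply: contra nleaf => du.
  by apply/exists_inP; exists u.
have [v vS] : exists v, v \in S by apply/card_gt0P; rewrite cardS.
(* An edge leaving [Y] starts at a vertex [a] of degree 2 in [S], which has at most one neighbour
   left in [Y]. *)
have dS : one_degenerate (S :\ v).
  move=> Y YS Y0; have [|a [b [aY bS bY ab]]] := connP _ cS Y _ Y0.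
    exact: sub_proper_trans YS (properD1 vS).
  exists a => //; have aS : a \in S.
    by have := subsetP YS a aY; rewrite inE => /andP[].
  have := deg2 a aS; rewrite (degD1 a bS) ab => -[<-]; apply: degS.
  by rewrite subsetD1 bY (subset_trans YS) // subD1set.
have cardN : #|ndel S v| = k.
  by have := card_ndel vS; rewrite card' // deg2 // addn2 => -[].
have low y : x <= y <= 0 -> up k x <= (1 + y) ^+ k.+1 + y.
  move=> /andP[xy y0]; apply: le_trans (up_mono k _ xy) _; first by lra.
  by rewrite /up exprS lerD // mulrC ler_wpM2r ?p0 //; lra.
have hF y : x <= y <= 0 -> (1 + y) ^+ k.+1 + y <= ip (S :\ v) y.
  move=> xy; apply: (forest_ip_ge dS (card' v vS)).
  - by case/andP: xy => xy ->; rewrite (lt_le_trans xN1 xy).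
  - exact: lt_le_trans (low y xy).
have gS' : good (S :\ v) x.
  apply: pos_good => // y xy; apply: lt_le_trans (hF y xy).
  exact: lt_le_trans (low y xy).
have := hF x; rewrite lexx x0 => /(_ isT) hx.
(* The star bound on [S :\ v] plus [x * (1 + x) ^+ k] is exactly [up k x]. *)
have := @ip_le_sub (ndel S v) set0 x x0 (ltW xN1) (goodS (ndel_sub _ _) gS') (sub0set _).
rewrite setD0 ip0 mulr1 cardN => /(ler_wnM2l x0).
by rewrite (ip_del _ vS) /up; rewrite exprS in hx; lra.
Qed.

End LowerBounds.

(** * Cycles and edge counts *)

Section Cycles.
Variable G : graph.
Implicit Types (S X Y C : {set G}) (u v w : G) (c : seq G).

(** A path is extended at its front as long as possible; once the front vertex has all its
    neighbours on the path, a cycle closes. *)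
Lemma min_deg2_cycle X : X != set0 -> (forall v, v \in X -> (1 < deg X v)%N) ->
  exists c, (3 <= size c)%N /\ ucycle (@adj G) c.
Proof.
move=> /set0Pn[x0 x0X] d2.
suff grow m : (exists c, (3 <= size c)%N /\ ucycle (@adj G) c) \/
    exists x p, [/\ path (@adj G) x p, uniq (x :: p), all [in X] (x :: p) & size p = m].
  have [//|[x [p [_ up aX sp]]]] := grow #|X|.
  have sub : {subset x :: p <= enum X} by move=> z /(allP aX); rewrite mem_enum.
  by have := uniq_leq_size up sub; rewrite -cardE /= sp ltnn.
elim: m => [|m [|[x [p [pp up aX sp]]]]]; [|by left|].
  by right; exists x0, [::]; rewrite /= x0X.
have xX : x \in X by move: aX => /= /andP[].
have /deg_gt1P[a [b [aX' bX ab xa xb]]] := d2 x xX.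
have ext z : z \in X -> adj x z -> z \notin x :: p ->
    exists x p, [/\ path (@adj G) x p, uniq (x :: p), all [in X] (x :: p) & size p = m.+1].
  move=> zX xz zp; exists z, (x :: p).
  by rewrite /= adj_sym xz pp zX -sp; split=> //; rewrite zp.
have [ap|ap] := boolP (a \in x :: p); last by right; exact: (ext a).
have [bp|bp] := boolP (b \in x :: p); last by right; exact: (ext b).
(* [head x p] is the vertex next to [x] on the path; a neighbour further along closes a cycle of
   length at least 3. *)
have [z [zp xz zh]] : exists z, [/\ z \in p, adj x z & z != head x p].
  have inp z : adj x z -> z \in x :: p -> z \in p.
    by move=> xz; rewrite inE => /predU1P[ez|//]; rewrite ez adj_irrefl in xz.
  have [ah|ah] := eqVneq a (head x p).
    by exists b; rewrite inp // xb eq_sym -ah ab.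
  by exists a; rewrite inp // xa ah.
left; move: up pp zh; case/path.splitP: zp => p1 p2.
rewrite -cat_cons cat_uniq cat_path => /andP[up _] /andP[pp _] zh.
exists (x :: rcons p1 z); split.
  by rewrite /= size_rcons; case: p1 zh {up pp} => //=; rewrite eqxx.
rewrite /ucycle up andbT /= rcons_path pp last_rcons adj_sym //.
Qed.

Lemma not_one_degenerate S : ~ one_degenerate S ->
  exists2 X : {set G}, X \subset S & X != set0 /\ forall v, v \in X -> (1 < deg X v)%N.
Proof.
move=> nd; have [/existsP[X /and3P[XS X0 /forall_inP d2]]|no] := boolP
  [exists X : {set G}, [&& X \subset S, X != set0 & [forall v in X, (1 < deg X v)%N]]].
  by exists X.
case: nd => Y YS Y0; have := no; rewrite negb_exists => /forallP/(_ Y).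
rewrite YS Y0 /= negb_forall => /existsP[v]; rewrite negb_imply -leqNgt => /andP[vY dv].
by exists v.
Qed.

Lemma forest_ne S : one_degenerate S -> S != set0 -> (ne S < #|S|)%N.
Proof.
elim/set_ind: S => S IH dS S0; have [u uS du] := dS S (subxx _) S0.
rewrite (neD1 uS) (cardsD1 u) uS add1n ltnS.
have [Su0|Su0] := eqVneq (S :\ u) set0.
  rewrite (degD1 u uS) adj_irrefl Su0 ne0 cards0 /deg leqn0 cards_eq0.
  by apply/eqP/setP => v; rewrite !inE.
have := IH _ (properD1 uS) (one_degenerateS (subD1set S u) dS) Su0.
by move: du; lia.
Qed.

Lemma cycle_deg c x : ucycle (@adj G) c -> (3 <= size c)%N -> x \in c ->
  (1 < deg [set y in c] x)%N.
Proof.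
move=> /andP[cc uc] sc xc; have [i c' ec] := rot_to xc.
have mem y : y \in c = (y \in x :: c') by rewrite -ec mem_rot.
rewrite -(rot_cycle i) ec in cc; rewrite -(rot_uniq i) ec in uc.
rewrite -(size_rot i) ec in sc.
case: c' {ec} mem cc uc sc => [|y [|z s]] // mem /=.
rewrite rcons_path => /and4P[xy yz _ zx] /and4P[_ ynz _ _] _.
apply/deg_gt1P; exists y, (last z s); rewrite !inE !mem xy adj_sym zx.
rewrite !in_cons eqxx orbT (_ : (last z s == z) || _) ?orbT; last by rewrite -in_cons mem_last.
by split=> //; apply: contra ynz => /eqP->; exact: mem_last.
Qed.

(** [C] grows to [S] by boundary vertices, each of which brings at least one edge. *)
Lemma conn_ne_ge S C : conn S -> C \subset S -> C != set0 -> (#|C| <= ne C)%N ->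
  (#|S| <= ne S)%N.
Proof.
move=> cS; have [m] := ubnP (#|S| - #|C|); elim: m C => // m IH C ltm CS C0 eC.
have [<-//|neCS] := eqVneq C S.
have [|u [v [uC vS vC uv]]] := connP _ cS C _ C0; first by rewrite properEneq neCS.
have vCS : v |: C \subset S by rewrite subUset sub1set vS.
apply: (IH (v |: C)) => //.
- by have := subset_leq_card vCS; rewrite cardsU1 vC; lia.
- by apply/set0Pn; exists v; rewrite setU11.
have dv : (0 < deg (v |: C) v)%N.
  by apply/card_gt0P; exists u; rewrite !inE uC orbT adj_sym.
rewrite cardsU1 vC add1n (@neD1 _ (v |: C) v) ?setU11 // setU1K //; lia.
Qed.

Lemma connected_conn : connected G -> conn [set: G].
Proof.
move=> cG; apply/connP => X XT /set0Pn[x xX].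
have [y _ yX] : exists2 y, y \in setT & y \notin X by case/properP: XT.
have [/existsP[u /existsP[v /and3P[uX vX uv]]]|no] := boolP
  [exists u, exists v, [&& u \in X, v \notin X & adj u v]].
  by exists u, v; rewrite inE.
have clX : closed (@adj G) (mem X).
  have imp u v : adj u v -> u \in X -> v \in X.
    move=> uv uX; apply: contraR no => vX.
    by apply/existsP; exists u; apply/existsP; exists v; rewrite uX vX.
  move=> u v uv; apply/idP/idP; first exact: imp.
  by apply: imp; rewrite adj_sym.
by have := closed_connect clX (cG x y); rewrite xX (negPf yX).
Qed.

Definition cycle_edges c := [set [set x; next c x] | x in c].

Lemma cycle_edges_mem c1 c2 : cycle_edges c1 = cycle_edges c2 -> c1 =i c2.
Proof.
have sub a b : cycle_edges a = cycle_edges b -> {subset a <= b}.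
  move=> e x xa; have : [set x; next a x] \in cycle_edges b by rewrite -e; apply: imset_f.
  case/imsetP=> y yb /setP/(_ x); rewrite !inE eqxx /=.
  by move=> /esym/orP[/eqP->//|/eqP->]; rewrite mem_next.
by move=> e x; apply/idP/idP; apply: sub.
Qed.

Lemma unicyclic_mem c1 c2 : connected_unicyclic G ->
  ucycle (@adj G) c1 -> ucycle (@adj G) c2 -> (3 <= size c1)%N -> (3 <= size c2)%N ->
  c1 =i c2.
Proof.
move=> [_ [E [_ uE]]] u1 u2 s1 s2; apply: cycle_edges_mem.
by rewrite -(uE (cycle_edges c1)) ?(uE (cycle_edges c2)) //; [exists c2 | exists c1].
Qed.

End Cycles.

(** * Edge count of a unicyclic graph *)

Section UnicyclicCounts.
Variable G : graph.
Implicit Types (S X Y C : {set G}) (u v w : G) (c : seq G).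

Section RemoveEdge.
Variables a b : G.

Definition adj_del u v := adj u v && ([set u; v] != [set a; b]).

Lemma adj_del_sym : symmetric adj_del.
Proof. by move=> u v; rewrite /adj_del adj_sym [in LHS]setUC. Qed.

Lemma adj_del_irrefl : irreflexive adj_del.
Proof. by move=> u; rewrite /adj_del adj_irrefl. Qed.

Definition del_edge : graph := Graph adj_del_sym adj_del_irrefl.

Lemma deg_del_edge S v : a \notin S -> a != v -> @deg del_edge S v = deg S v.
Proof.
move=> aS av; apply: eq_card => u; rewrite !inE /= /adj_del.
have [uS|//] := boolP (u \in S); rewrite /= andb_idr // => _.
apply: contraNneq aS => /setP/(_ a); rewrite !inE eqxx /= (negPf av) /=.
by move/eqP->.
Qed.

Lemma ne_del_edge S : a \notin S -> @ne del_edge S = ne S.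
Proof.
move=> aS; congr _./2; apply: eq_bigr => v vS; rewrite deg_del_edge //.
by apply: contraNneq aS => ->.
Qed.

Lemma ne_del_edge_le S : (ne S <= (@ne del_edge S).+1)%N.
Proof.
have [aS|aS] := boolP (a \in S); last by rewrite ne_del_edge.
rewrite (neD1 aS) (@neD1 del_edge S a aS) -addnS.
rewrite [@ne del_edge _](@ne_del_edge (S :\ a)) ?inE ?eqxx // leq_add2l.
rewrite -addn1 -(cards1 b); apply: leq_trans (leq_card_setU _ _).
apply/subset_leq_card/subsetP => u; rewrite !inE /= /adj_del => /andP[-> au].
rewrite au /=; have [->|ub] := eqVneq u b; first by rewrite orbT.
rewrite orbF; apply: contra ub => /eqP/setP/(_ u).
rewrite !inE eqxx orbT => /esym/orP[/eqP eu|//].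
by rewrite eu adj_irrefl in au.
Qed.

End RemoveEdge.

(** Without an edge [a b] of the cycle the graph is a forest, which bounds the edges from above;
    growing the cycle to the whole graph bounds them from below. Deleting [a] also destroys the edge
    [a b]. *)
Lemma unicyclic_counts : connected_unicyclic G ->
  ne [set: G] = #|G| /\ exists a : G, one_degenerate ([set: G] :\ a).
Proof.
move=> [cG [E [[c [sc uc eE]] uE]]]; have cT := connected_conn cG.
have [a ac] : exists a, a \in c by case: c sc {uc eE} => // a c _; exists a; rewrite mem_head.
set b := next c a.
(* A cycle surviving the deletion would be the unique one, which uses the edge [a b]. *)
have dG : @one_degenerate (del_edge a b) setT.
  apply: boolp.contrapT => /(@not_one_degenerate (del_edge a b))[X _ [X0 d2]].
  have [c' [sc' /andP[cc' uc']]] := @min_deg2_cycle (del_edge a b) X X0 d2.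
  have eE' : cycle_edges c' = E.
    apply/esym/uE; exists c'; split=> //; rewrite /ucycle uc' andbT.
    by apply: (sub_cycle (e := adj_del a b)) cc' => u v /andP[].
  have : [set a; b] \in cycle_edges c' by rewrite eE' eE; apply: imset_f.
  case/imsetP=> x xc' exy; have := next_cycle cc' xc'.
  by rewrite /= /adj_del exy eqxx andbF.
split; last first.
  exists a => Y YS Y0; have [|v vY dv] := dG Y _ Y0; first exact: subsetT.
  have aY : a \notin Y by apply/negP => /(subsetP YS); rewrite !inE eqxx.
  by exists v; rewrite // -(@deg_del_edge a b) //; apply: contraNneq aY => ->.
have G0 : [set: G] != set0 by apply/set0Pn; exists a.
apply/eqP; rewrite eqn_leq -cardsT; apply/andP; split.
  apply: leq_trans (ne_del_edge_le a b _) _.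
  exact: (@forest_ne (del_edge a b) setT dG G0).
apply: (@conn_ne_ge _ setT [set x in c]) => //.
  by apply/set0Pn; exists a; rewrite inE.
rewrite -leq_double -dsum_even /dsum -muln2 -sum_nat_const; apply: leq_sum => x.
by rewrite inE => xc; apply: cycle_deg.
Qed.

End UnicyclicCounts.

(** * Hall's theorem and very well-covered graphs *)

Section Hall.
Variable T : finType.
Implicit Types (A X Y : {set T}) (r : rel T).

Definition nbhd r X := [set y | [exists x in X, r x y]].

Lemma nbhdP r X y : reflect (exists2 x, x \in X & r x y) (y \in nbhd r X).
Proof. by rewrite inE; exact: exists_inP. Qed.

Lemma nbhdU r X Y : nbhd r (X :|: Y) = nbhd r X :|: nbhd r Y.
Proof.
apply/setP => y; rewrite in_setU; apply/nbhdP/orP.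
  by case=> x; rewrite inE => /orP[] xX rxy; [left | right]; apply/nbhdP; exists x.
by case=> /nbhdP[x xX rxy]; exists x; rewrite // inE xX ?orbT.
Qed.

(** A nonempty proper tight set [X0] is matched first and the rest is matched outside [nbhd r X0].
    If no set is tight, any pair [a], [b] can be matched and removed. *)
Lemma Hall_marriage r A : (forall X, X \subset A -> (#|X| <= #|nbhd r X|)%N) ->
  exists2 f : T -> T, {in A &, injective f} & {in A, forall x, r x (f x)}.
Proof.
elim/set_ind: A r => A IH r hall.
have [->|[a aA]] := set_0Vmem A; first by exists id => x; rewrite inE.
have [/existsP[X0 /and3P[X0A X00 tight]]|loose] := boolP
  [exists X0 : {set T}, [&& X0 \proper A, X0 != set0 & (#|nbhd r X0| <= #|X0|)%N]].
  have [f1 inj1 r1] := IH X0 X0A r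
    (fun X XX0 => hall X (subset_trans XX0 (proper_sub X0A))).
  pose r' x y := r x y && (y \notin nbhd r X0).
  have pD : A :\: X0 \proper A.
    have /set0Pn[z zX0] := X00; have zA := subsetP (proper_sub X0A) z zX0.
    by rewrite properE subsetDl; apply/subsetPn; exists z; rewrite // inE zX0.
  have [|f2 inj2 r2] := IH (A :\: X0) pD r'.
    move=> X XD; have dX : [disjoint X0 & X].
      by rewrite disjoint_sym; apply: disjointWl XD _; rewrite -setI_eq0; apply/eqP/setP => y; rewrite !inE; case: (y \in X0); rewrite ?andbF.
    have XA : X0 :|: X \subset A.
      by rewrite subUset (proper_sub X0A) (subset_trans XD) // subsetDl.
    have := hall _ XA; rewrite nbhdU cardsU (disjoint_setI0 dX) cards0 subn0.
    have -> : nbhd r X0 :|: nbhd r X = nbhd r X0 :|: nbhd r' X.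
      apply/setP => y; rewrite !in_setU; have [//|yX0] := boolP (y \in nbhd r X0).
      by apply/nbhdP/nbhdP => -[x xX] rxy; exists x => //; move: rxy; rewrite /r' yX0 andbT.
    have le : (#|nbhd r X0 :|: nbhd r' X| <= #|nbhd r X0| + #|nbhd r' X|)%N.
      exact: leq_card_setU.
    by move: le tight; lia.
  exists (fun x => if x \in X0 then f1 x else f2 x); last first.
    move=> x xA; have [xX0|xX0] := boolP (x \in X0); first exact: r1.
    by have := r2 x; rewrite inE xX0 xA => /(_ isT)/andP[].
  have cross x y : x \in X0 -> y \in A -> y \notin X0 -> f1 x <> f2 y.
    move=> xX0 yA yX0 e; have := r2 y; rewrite inE yX0 yA => /(_ isT)/andP[_].
    by rewrite -e => /nbhdP[]; exists x; rewrite // r1.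
  move=> x y xA yA; have [xX0|xX0] := boolP (x \in X0); have [yX0|yX0] := boolP (y \in X0).
  - exact: inj1.
  - by move/cross => /(_ xX0 yA yX0).
  - by move/esym/cross => /(_ yX0 xA xX0).
  - by apply: inj2; rewrite inE ?xX0 ?yX0.
have [b rab] : exists b, r a b.
  have := hall [set a]; rewrite sub1set cards1 => /(_ aA)/card_gt0P[b /nbhdP[x /set1P->]].
  by exists b.
pose r' x y := r x y && (y != b).
have [|f injf rf] := IH (A :\ a) (properD1 aA) r'.
  move=> X XA; have [->|X0] := eqVneq X set0; first by rewrite cards0.
  have pX : X \proper A := sub_proper_trans XA (properD1 aA).
  have lt : (#|X| < #|nbhd r X|)%N.
    rewrite ltnNge; apply: contra loose => le; apply/existsP; exists X.
    by rewrite pX X0.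
  rewrite -ltnS; apply: leq_trans lt _; rewrite (cardsD1 b) -add1n leq_add ?leq_b1 //.
  apply/subset_leq_card/subsetP => y; rewrite !inE => /andP[yb /exists_inP[x xX rxy]].
  by apply/exists_inP; exists x; rewrite // /r' rxy.
exists (fun x => if x == a then b else f x); last first.
  move=> x xA; have [->//|xa] := eqVneq x a.
  by have := rf x; rewrite !inE xa xA => /(_ isT)/andP[].
have cross x : x \in A -> x != a -> f x != b.
  by move=> xA xa; have := rf x; rewrite !inE xa xA => /(_ isT)/andP[].
move=> x y xA yA; have [->|xa] := eqVneq x a; have [->|ya] := eqVneq y a => //.
- by move=> e; have := cross y yA ya; rewrite -e eqxx.
- by move=> e; have := cross x xA xa; rewrite e eqxx.
- by apply: injf; rewrite !inE ?xa ?ya.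
Qed.

End Hall.

(** * Well-covered graphs: Berge's inequality and the perfect matching *)

Section VeryWellCovered.
Variable G : graph.
Implicit Types (S X Y A W I : {set G}) (u v w x y a b : G).

(** Choosing a vertex of degree at most 1 discards at most two vertices. *)
Lemma forest_independent S : one_degenerate S ->
  exists I, [/\ I \subset S, independent I & (#|S| <= #|I|.*2)%N].
Proof.
elim/set_ind: S => S IH dS.
have [->|S0] := eqVneq S set0.
  by exists set0; rewrite sub0set independent0 cards0.
have [u uS du] := dS S (subxx _) S0.
have nS : ndel S u \proper S := sub_proper_trans (ndel_sub S u) (properD1 uS).
have [I [IS iI leI]] := IH _ nS (one_degenerateS (proper_sub nS) dS).
have uI : u \notin I by apply/negP => /(subsetP IS); rewrite !inE eqxx.
exists (u |: I); split.
- by rewrite subUset sub1set uS (subset_trans IS) // proper_sub.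
- rewrite independentU1 // iI; apply/forall_inP => v /(subsetP IS).
  by rewrite inE => /andP[].
have := card_ndel uS; have := cardsD1 u S; rewrite uS cardsU1 uI => -> <-.
by move: du leI; lia.
Qed.

Lemma maximal_independent I : independent I ->
  exists2 W, maxset (@independent G) W & I \subset W.
Proof. by move=> iI; have [W mW IW] := maxset_exists iI; exists W. Qed.

Hypotheses (wcG : well_covered G) (noiso : forall v, exists u, adj v u).

Lemma independent_le_card W I : maxset (@independent G) W -> independent I ->
  (#|I| <= #|W|)%N.
Proof.
move=> mW /maximal_independent[W' mW' IW']; rewrite (wcG mW mW').
exact: subset_leq_card.
Qed.

(** Replacing the neighbours of [A] in [W] by [A] keeps independence, and no independent set is
    larger than [W]. *)
Lemma exchange_card W A : maxset (@independent G) W -> independent A ->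
  [disjoint A & W] -> (#|A| <= #|nbhd (@adj G) A :&: W|)%N.
Proof.
move=> mW iA dAW; set N := nbhd _ A; have /maxsetP[iW _] := mW.
have iU : independent (A :|: (W :\: N)).
  have cross u v : u \in A -> v \in W :\: N -> ~~ adj u v.
    by move=> uA; rewrite inE => /andP[vN _]; apply: contra vN => uv; apply/nbhdP; exists u.
  apply/independentP => u v /setUP[uA|uW] /setUP[vA|vW].
  - exact: (independentP _ iA).
  - exact: cross.
  - by rewrite adj_sym cross.
  - by apply: (independentP _ iW); [case/setDP: uW | case/setDP: vW].
have := independent_le_card mW iU.
have dAD : [disjoint A & W :\: N] by apply: disjointWr dAW; exact: subsetDl.
rewrite cardsU (disjoint_setI0 dAD) cards0 subn0 cardsD setIC.
have le : (#|N :&: W| <= #|W|)%N := subset_leq_card (subsetIr N W).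
by move=> h; rewrite -(leq_add2r (#|W| - #|N :&: W|)) subnKC.
Qed.

(* Berge: exchange against a maximal independent set through a neighbour of [A]. *)
Lemma card_le_nbhd A : independent A -> (#|A| <= #|nbhd (@adj G) A|)%N.
Proof.
elim/set_ind: A => A IH iA; have [->|[a aA]] := set_0Vmem A; first by rewrite cards0.
have [u au] := noiso a.
have iu : independent [set u].
  by apply/independentP => v w /set1P-> /set1P->; rewrite adj_irrefl.
(* [W] contains the neighbour [u] of [a], hence not [a], so [A :&: W] is a proper subset of [A]. *)
have [W mW] := maximal_independent iu; rewrite sub1set => uW.
have /maxsetP[iW _] := mW.
have aW : a \notin W by apply: contraL au => aW; apply: (independentP _ iW).
have pA : A :&: W \proper A.
  by rewrite properE subsetIl; apply/subsetPn; exists a; rewrite // inE (negPf aW) andbF.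
have h1 := IH _ pA (independentS (proper_sub pA) iA).
have dD : [disjoint A :\: W & W] by rewrite -setI_eq0; apply/eqP/setP => y; rewrite !inE; case: (y \in W); rewrite ?andbF.
have h2 := exchange_card mW (independentS (subsetDl A W) iA) dD.
rewrite -(cardsID W A) -{3}(setID A W) nbhdU.
apply: leq_trans (leq_add h1 h2) _.
set N1 := nbhd _ _; set N2 := nbhd _ _.
(* Neighbours of [A :&: W] lie outside the independent set [W], so the two counts do not overlap. *)
have dN : N1 :&: (N2 :&: W) = set0.
  apply/setP => y; rewrite !inE; apply/negP => /and3P[/exists_inP[x /setIP[xA xW] xy] _ yW].
  by have := independentP _ iW x y xW yW; rewrite xy.
have := cardsUI N1 (N2 :&: W); rewrite dN cards0 addn0 => <-.
by apply/subset_leq_card/setUS/subsetIl.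
Qed.

Lemma perfect_matching n S : #|G| = n.*2 -> maxset (@independent G) S -> (n <= #|S|)%N ->
  #|S| = n /\ exists m : G -> G,
    [/\ involutive m, forall x, adj x (m x) & forall x, (m x \in S) = (x \notin S)].
Proof.
move=> cG mS nS; have /maxsetP[iS _] := mS.
have [X XS|f injf adjf] := @Hall_marriage _ (@adj G) S.
  exact/card_le_nbhd/(independentS XS).
have fS x : x \in S -> f x \in ~: S.
  move=> xS; rewrite inE; apply/negP => fxS.
  by have := independentP _ iS x (f x) xS fxS; rewrite adjf.
have cI : #|f @: S| = #|S| by apply: card_in_imset.
have sI : f @: S \subset ~: S by apply/subsetP => y /imsetP[x xS ->]; exact: fS.
have cC := cardsC S; rewrite cG in cC.
have cS : #|S| = n.
  have le : (#|S| <= #|~: S|)%N by rewrite -cI; exact: subset_leq_card.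
  by move: cC nS le; lia.
split=> //.
have eI : f @: S = ~: S by apply/eqP; rewrite eqEcard sI cI; move: cC cS; lia.
(* Off [S], [m] is the inverse of [f]; the default [x] never occurs because [f] maps [S] onto its
   complement. *)
pose m x := if x \in S then f x else odflt x [pick s in S | f s == x].
have mN x : x \notin S -> m x \in S /\ f (m x) = x.
  move=> xS; rewrite /m (negPf xS); case: pickP => [s /andP[sS /eqP fs]|no] //=.
  have : x \in f @: S by rewrite eI inE.
  by case/imsetP=> s sS xe; have := no s; rewrite sS xe eqxx.
have mS' x : x \in S -> m x = f x by move=> xS; rewrite /m xS.
exists m; split.
- move=> x; have [xS|xS] := boolP (x \in S); last first.
    by have [mx fm] := mN x xS; rewrite mS'.
  have := fS x xS; rewrite -mS' // inE => nS'; have [mx fm] := mN _ nS'.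
  by apply: injf => //; rewrite fm mS'.
- move=> x; have [xS|xS] := boolP (x \in S); first by rewrite mS' ?adjf.
  by have [mx fm] := mN x xS; rewrite adj_sym -{2}fm adjf.
move=> x; have [xS|xS] := boolP (x \in S); last by have [-> _] := mN x xS.
by rewrite mS' //; have := fS x xS; rewrite inE => /negPf.
Qed.

(** If [a] and [b] were not adjacent, a maximal independent set containing both would meet the edge
    from [x] to [m x], hence contain a neighbour of [a] or [b]. With [a = b] this excludes triangles
    on matching edges. *)
Lemma matching_complete n (m : G -> G) S : #|G| = n.*2 -> maxset (@independent G) S ->
  #|S| = n -> involutive m -> (forall x, adj x (m x)) ->
  forall x a b, adj x a -> a != m x -> adj (m x) b -> b != x -> adj a b.
Proof.
move=> cG mS cS mK adjm x a b xa am mb bx; apply/negPn/negP => nab.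
have iab : independent [set a; b].
  apply/independentP => u v; rewrite !inE => /orP[]/eqP-> /orP[]/eqP->;
  by rewrite ?adj_irrefl // adj_sym.
have [W mW] := maximal_independent iab; rewrite subUset !sub1set => /andP[aW bW].
have /maxsetP[iW _] := mW; have cW : #|W| = n by rewrite -cS; apply: wcG.
(* [W] and its image under [m] are disjoint of size [n] each, so together they cover the graph. *)
have mem z : (z \in W) || (m z \in W).
  have dW : W :&: m @: W = set0.
    apply/setP => y; rewrite in_setI in_set0; apply/negP => /andP[yW /imsetP[w wW yw]].
    by have := independentP _ iW w y wW yW; rewrite yw adjm.
  have : W :|: m @: W = setT.
    apply/eqP; rewrite eqEcard subsetT cardsT cG cardsU dW cards0 subn0.
    by rewrite (card_imset _ (inv_inj mK)) cW addnn /=.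
  move=> /setP/(_ z); rewrite !inE => /orP[->//|/imsetP[w wW ->]].
  by rewrite mK wW orbT.
have := mem x => /orP[xW|mxW].
  by have := independentP _ iW x a xW aW; rewrite xa.
by have := independentP _ iW (m x) b mxW bW; rewrite mb.
Qed.

End VeryWellCovered.

(** * Contracting the perfect matching *)

Section Pendant.
Variables (F : fieldType) (G : graph).
Implicit Types (A B S : {set G}) (u v : G).

Lemma ip_independent S (x : F) : independent S -> ip S x = (1 + x) ^+ #|S|.
Proof.
elim/set_ind: S => S IH iS.
have [->|[v vS]] := set_0Vmem S; first by rewrite ip0 cards0.
have -> : ip S x = (1 + x) * ip (S :\ v) x.
  rewrite (ip_del _ vS) mulrDl mul1r; congr (_ + _ * ip _ _).
  apply/setP => u; rewrite !inE andbC; have [uS|] := boolP (u \in S); rewrite ?andbF //.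
  by rewrite (independentP _ iS).
rewrite IH ?properD1 //; last exact: independentS (subD1set S v) iS.
by rewrite -exprS (cardsD1 v S) vS.
Qed.

(** Leaves of vertices outside [A] are isolated and contribute factors [1 + x]. Selecting [v]
    discards its leaf and one such factor, which turns the weight [x] into [x / (1 + x)]. *)
Lemma ip_pendant (l : G -> G) A B (x : F) : 1 + x != 0 -> A \subset B ->
  {in B &, forall u v, adj u (l v) = (u == v)} ->
  {in B &, forall u v, ~~ adj (l u) (l v)} ->
  ip (A :|: l @: B) x = (1 + x) ^+ #|B| * ip A (x / (1 + x)).
Proof.
move=> x1; elim/set_ind: A B => A IH B AB hl hll.
have linj : {in B &, injective l}.
  by move=> u v uB vB e; apply/eqP; rewrite -hl // -e hl.
have lB v : v \in B -> l v \notin B.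
  by move=> vB; apply/negP => lvB; have := hll v (l v) vB lvB; rewrite hl // eqxx.
have [->|[v vA]] := set_0Vmem A.
  rewrite set0U ip0 mulr1 ip_independent ?card_in_imset //.
  by apply/independentP => u w /imsetP[u' u'B ->] /imsetP[w' w'B ->]; exact: hll.
have vB := subsetP AB v vA.
have vl : v \notin l @: B by apply/negP => /imsetP[w wB e]; have := lB w wB; rewrite -e vB.
rewrite (ip_del _ vA) (@ip_del _ _ (A :|: l @: B) v); last by rewrite inE vA.
have -> : (A :|: l @: B) :\ v = (A :\ v) :|: l @: B.
  apply/setP => u; rewrite !inE andb_orr; congr (_ || _).
  by have [->|//] := eqVneq u v; rewrite (negPf vl).
have -> : ndel (A :|: l @: B) v = ndel A v :|: l @: (B :\ v).
  apply/setP => u; rewrite in_setU !in_set andb_orr andb_orl; congr (_ || _).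
  apply/idP/imsetP => [/andP[/andP[uv /imsetP[w wB e]]]|[w]].
    by rewrite e hl // => vw; exists w; rewrite // !inE wB eq_sym vw.
  rewrite !inE => /andP[wv wB] ->; rewrite hl // [v == w]eq_sym wv imset_f // !andbT.
  by apply: contraNneq (lB w wB) => ->.
have nA : ndel A v \proper A := sub_proper_trans (ndel_sub A v) (properD1 vA).
have nB : ndel A v \subset B :\ v := subset_trans (ndel_sub A v) (setSD _ AB).
rewrite (IH _ (properD1 vA) B) //; last exact: subset_trans (subD1set A v) AB.
rewrite (IH _ nA (B :\ v)) //; first last.
- by move=> u w /(subsetP (subD1set _ _)) uB /(subsetP (subD1set _ _)) wB; exact: hll.
- by move=> u w /(subsetP (subD1set _ _)) uB /(subsetP (subD1set _ _)) wB; exact: hl.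
by rewrite (cardsD1 v B) vB add1n exprS; field.
Qed.

End Pendant.

Lemma eq_ip (G : graph) (r : rel G) (rs : symmetric r) (ri : irreflexive r)
    (K : nzSemiRingType) (A : {set G}) (x : K) :
  {in A &, r =2 adj} -> @ip (Graph rs ri) K A x = ip A x.
Proof.
move=> e; apply: eq_bigl => B; have [BA|//] := boolP (B \subset A).
have BAP := subsetP BA.
apply/independentP/independentP => h u v uB vB; have := h u v uB vB;
by rewrite /= e // BAP.
Qed.

Lemma degE (G : graph) (A : {set G}) u : deg A u = (\sum_(v in A) adj u v)%N.
Proof.
by rewrite /deg -sum1_card big_mkcond [RHS]big_mkcond; apply: eq_bigr => v _;
  rewrite !inE; case: (v \in A); case: (adj u v).
Qed.

Lemma degET (G : graph) (u : G) : deg [set: G] u = (\sum_v adj u v)%N.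
Proof. by rewrite degE; apply: eq_bigl => v; rewrite inE. Qed.

(** * Contraction of the matching in the unicyclic case *)

Section Quotient.
Variables (G : graph) (n : nat) (m : G -> G) (S : {set G}).
Hypotheses (Guni : connected_unicyclic G) (hn : (3 <= n)%N) (cG : #|G| = n.*2).
Hypotheses (mK : involutive m) (adjm : forall x, adj x (m x)).
Hypothesis mS : forall x, (m x \in S) = (x \notin S).
Hypothesis complete : forall x a b : G,
  adj x a -> a != m x -> adj (m x) b -> b != x -> adj a b.
Implicit Types (A X Y : {set G}) (x y z a b u v : G).

Let cT : conn [set: G]. Proof. exact: connected_conn (proj1 Guni). Qed.

Let eqm x y : (m x == m y) = (x == y). Proof. exact/inj_eq/inv_inj. Qed.

Let eqmC x y : (x == m y) = (m x == y). Proof. by rewrite -(inj_eq (inv_inj mK)) mK. Qed.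

Let adjmC x : adj (m x) x. Proof. by rewrite adj_sym. Qed.

Let neqm x : x != m x.
Proof. by apply/eqP => e; have := adjm x; rewrite -e adj_irrefl. Qed.

Lemma adj_neq x y : adj x y -> x != y.
Proof. by apply: contraTneq => ->; rewrite adj_irrefl. Qed.

Lemma small_not_closed X : X != set0 -> (#|X| < 6)%N ->
  ~ {in X, forall u v, adj u v -> v \in X}.
Proof.
move=> X0 X6 cX; have [|u [v [uX _ vX uv]]] := connP _ cT X _ X0.
  by rewrite properEcard subsetT cardsT cG; move: X6 hn; lia.
by have := cX u uX v uv; rewrite (negPf vX).
Qed.

Definition nonleaf v := [exists a, (a != m v) && adj v a].

Lemma nonleafI v a : adj v a -> a != m v -> nonleaf v.
Proof. by move=> va am; apply/existsP; exists a; rewrite am. Qed.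

Lemma leaf_nbr v a : ~~ nonleaf v -> adj v a -> a = m v.
Proof. by move=> nl va; apply/eqP; apply: contraNT nl; exact: nonleafI. Qed.

Lemma four_cycle x a b : adj x a -> a != m x -> adj (m x) b -> b != x ->
  ucycle (@adj G) [:: x; m x; b; a].
Proof.
move=> xa am mb bx; have ab := complete xa am mb bx.
rewrite /ucycle /= adjm mb [adj b a]adj_sym ab [adj a x]adj_sym xa /=.
rewrite !inE !negb_or (adj_neq (adjm x)) [x == b]eq_sym bx (adj_neq xa).
by rewrite (adj_neq mb) [m x == a]eq_sym am eq_sym (adj_neq ab).
Qed.

(** Two choices of [a] would give 4-cycles with different vertex sets. *)
Lemma nonleaf_nbr_uniq x a a' : nonleaf (m x) ->
  adj x a -> a != m x -> adj x a' -> a' != m x -> a = a'.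
Proof.
case/existsP=> b; rewrite mK => /andP[bx mb] xa am xa' am'.
have := unicyclic_mem Guni (four_cycle xa am mb bx) (four_cycle xa' am' mb bx) isT isT a.
rewrite !inE eqxx !orbT (negPf am) [a == x]eq_sym (negPf (adj_neq xa)).
by rewrite (negPf (adj_neq (complete xa am mb bx))) => /esym/eqP.
Qed.

(** All four ends would be non-leaves, each with a single neighbour besides its partner, so they
    would form a component of a connected graph with at least 6 vertices. *)
Lemma no_parallel_edges x a : adj x a -> a != m x -> adj (m x) (m a) -> False.
Proof.
move=> xa am mxa.
have nx : nonleaf x by apply: nonleafI am.
have nmx : nonleaf (m x) by apply: (nonleafI mxa); rewrite eqm.
have xma : x != m a by rewrite eqmC eq_sym.
have na : nonleaf a by apply: (nonleafI (a := x)); rewrite // adj_sym.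
have nma : nonleaf (m a) by by apply: (nonleafI (a := m x)); rewrite 1?adj_sym // mK eq_sym.
have close u v w : nonleaf (m u) -> adj u w -> w != m u -> adj u v -> v = m u \/ v = w.
  move=> nmu uw wmu uv; have [|vmu] := eqVneq v (m u); first by left.
  by right; apply: nonleaf_nbr_uniq nmu uv vmu uw wmu.
apply: (@small_not_closed [set z in [:: x; m x; a; m a]]).
- by apply/set0Pn; exists x; rewrite !inE eqxx.
- by rewrite cardsE; apply: leq_ltn_trans (card_size _) _.
move=> u + v; rewrite !inE => /or4P[]/eqP-> uv.
- by have [->|->] := close x v a nmx xa am uv; rewrite eqxx ?orbT.
- have nmmx : nonleaf (m (m x)) by rewrite mK.
  have mamx : m a != m (m x) by rewrite eqm.
  by have [->|->] := close (m x) v (m a) nmmx mxa mamx uv; rewrite ?mK eqxx ?orbT.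
- have ax : adj a x by rewrite adj_sym.
  by have [->|->] := close a v x nma ax xma uv; rewrite eqxx ?orbT.
have nmma : nonleaf (m (m a)) by rewrite mK.
have mamx : adj (m a) (m x) by rewrite adj_sym.
have mxa' : m x != m (m a) by rewrite mK eq_sym.
by have [->|->] := close (m a) v (m x) nmma mamx mxa' uv; rewrite ?mK eqxx ?orbT.
Qed.

(** Each such matching edge lies on a 4-cycle. By uniqueness it is the same cycle, so two of them
    would be opposite sides, joined by parallel edges. *)
Lemma nonleaf_pair_uniq x z : nonleaf x -> nonleaf (m x) -> nonleaf z -> nonleaf (m z) ->
  z = x \/ z = m x.
Proof.
move=> /existsP[a /andP[am xa]] /existsP[b]; rewrite mK => /andP[bx mb].
move=> /existsP[c /andP[cm zc]] /existsP[d]; rewrite mK => /andP[dz md].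
have e := unicyclic_mem Guni (four_cycle xa am mb bx) (four_cycle zc cm md dz) isT isT.
have [|zx] := eqVneq z x; first by left.
have [|zmx] := eqVneq z (m x); first by right.
have ez := e z; have emz := e (m z).
have mzx : (m z == x) = false by rewrite -eqmC (negPf zmx).
move: ez emz; rewrite !inE !eqxx /= !orbT eqm (negPf zx) (negPf zmx) mzx /=.
move=> /orP[]/eqP ez /orP[]/eqP emz.
- by have := adjm z; rewrite emz -ez adj_irrefl.
- case: (@no_parallel_edges x (m z)).
  + by rewrite emz.
  + by rewrite eqm.
  by rewrite mK ez.
- case: (@no_parallel_edges x z); first by rewrite ez.
    by [].
  by rewrite emz.
by have := adjm z; rewrite emz -ez adj_irrefl.
Qed.

Lemma nonleaf_or v : nonleaf v || nonleaf (m v).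
Proof.
apply: contraT; rewrite negb_or => /andP[nv nmv].
case: (@small_not_closed [set z in [:: v; m v]]).
- by apply/set0Pn; exists v; rewrite !inE eqxx.
- by rewrite cardsE; apply: leq_ltn_trans (card_size _) _.
move=> u + w; rewrite !inE => /orP[]/eqP-> uw.
  by rewrite (leaf_nbr nv uw) eqxx orbT.
by rewrite (leaf_nbr nmv uw) mK eqxx.
Qed.

(** One end of each matching edge: the non-leaf one, with [S] deciding when neither end is a
    leaf. *)
Definition transv := [set v | nonleaf v && (~~ nonleaf (m v) || (v \in S))].

Local Notation T := transv.

Lemma transv_m v : (m v \in T) = (v \notin T).
Proof.
rewrite !inE mK mS; have := nonleaf_or v.
by case: (nonleaf v); case: (nonleaf (m v)); case: (v \in S).
Qed.

Lemma transvC : ~: T = m @: T.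
Proof.
apply/setP => v; rewrite in_setC -transv_m; apply/idP/imsetP => [vT|[u uT ->]].
  by exists (m v); rewrite ?mK.
by rewrite mK.
Qed.

Lemma card_transv : #|T| = n.
Proof.
have := cardsC T; rewrite transvC card_imset; last exact: inv_inj.
by rewrite cG; lia.
Qed.

(* [T] represents the matching edges, and [quot_adj] is adjacency in the
   contraction of the matching. *)
Definition quot_adj u v :=
  [&& u != v, u != m v & [|| adj u v, adj u (m v), adj (m u) v | adj (m u) (m v)]].

Lemma quot_adj_sym : symmetric quot_adj.
Proof.
move=> u v; rewrite /quot_adj [v == u]eq_sym [v == m u]eq_sym -eqmC.
rewrite [adj v u]adj_sym [adj v (m u)]adj_sym [adj (m v) u]adj_sym [adj (m v) (m u)]adj_sym.
by congr [&& _, _ & _ || _]; rewrite orbCA.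
Qed.

Lemma quot_adj_irrefl : irreflexive quot_adj.
Proof. by move=> u; rewrite /quot_adj eqxx. Qed.

Definition quot : graph := Graph quot_adj_sym quot_adj_irrefl.

Lemma quot_conn : @conn quot T.
Proof.
apply/connP => X XT /set0Pn[x xX]; have XsT := subsetP (proper_sub XT).
(* [X :|: m @: X] is the preimage of [X] under contraction; an edge leaving it projects to an edge
   leaving [X]. *)
have sub : X :|: m @: X \proper [set: G].
  rewrite properE subsetT; have /properP[_ [y yT yX]] := XT.
  apply/subsetPn; exists y => //; rewrite inE negb_or yX /=.
  by apply/imsetP => -[z zX e]; move: yT; rewrite e transv_m XsT.
have [|p [q [pX _ qX pq]]] := connP _ cT _ sub.
  by apply/set0Pn; exists x; rewrite inE xX.
have rep z : exists2 w, w \in T & z = w \/ z = m w.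
  have [zT|] := boolP (z \in T); first by exists z => //; left.
  by rewrite -transv_m; exists (m z); rewrite ?mK //; right.
have [u uX ep] : exists2 u, u \in X & p = u \/ p = m u.
  by case/setUP: pX => [pX|/imsetP[u uX ->]]; [exists p => //; left | exists u => //; right].
have [v vT eq] := rep q.
have vX : v \notin X.
  apply: contra qX => vX; case: eq => ->; first by rewrite inE vX.
  by rewrite inE imset_f ?orbT.
exists u, v; split=> //=; rewrite /quot_adj; apply/and3P; split.
- by apply: contraNneq vX => <-.
- by apply/eqP => e; have := XsT u uX; rewrite e transv_m vT.
by case: ep eq pq => -> [] -> ->; rewrite ?orbT.
Qed.

Lemma sum_transv (f : G -> nat) :
  (\sum_v f v = \sum_(v in T) (f v + f (m v)))%N.
Proof.
rewrite (bigID [in T]) /= big_split /=; congr (_ + _)%N.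
rewrite (reindex_inj (inv_inj mK)); apply: eq_bigl => v.
by rewrite /= transv_m negbK.
Qed.

(** Two distinct matching edges are joined at most once: two joining edges with a common end make a
    triangle on a matching edge, and disjoint ones are parallel. *)
Lemma one_edge u v : u != v -> u != m v ->
  (adj u v + adj u (m v) + (adj (m u) v + adj (m u) (m v)))%N = quot_adj u v.
Proof.
move=> uv umv; rewrite /quot_adj uv umv /=.
have excl x y : x != y -> x != m y -> adj x y -> adj x (m y) = false.
  move=> xy xmy h; apply/negP => h'.
  have := @complete y x x; rewrite adj_sym h xmy adj_sym h' xy adj_irrefl.
  by move=> /(_ isT isT isT isT).
have par x y : x != y -> x != m y -> adj x y -> adj (m x) (m y) = false.
  move=> xy xmy h; apply/negP => h'; apply: (no_parallel_edges h) h'.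
  by rewrite eq_sym -eqmC.
have vu : v != u by rewrite eq_sym.
have vmu : v != m u by rewrite eqmC eq_sym.
have [h|h1] := boolP (adj u v).
  rewrite (excl _ _ uv umv h) (par _ _ uv umv h).
  by move: h; rewrite adj_sym => /(excl _ _ vu vmu); rewrite adj_sym => ->.
have [h|h2] := boolP (adj u (m v)).
  have := par u (m v); rewrite mK umv uv => /(_ isT isT h) ->.
  have := excl (m v) u; rewrite eq_sym umv eqm vu adj_sym h => /(_ isT isT isT).
  by rewrite adj_sym => ->.
have [h|h3] := boolP (adj (m u) v); last by rewrite orFb; case: (adj _ _).
have := excl (m u) v; rewrite eq_sym vmu eqm uv h => /(_ isT isT isT) ->.
by [].
Qed.

(** Of the [2n] edges, contraction removes the [n] matching edges and identifies no others, by
    [one_edge]. *)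
Lemma quot_ne : ne [set: G] = #|G| -> @ne quot T = n.
Proof.
move=> eG; have := dsum_even [set: G]; rewrite eG cG.
rewrite /dsum (eq_bigl xpredT) => [|u]; last by rewrite inE.
rewrite sum_transv => e; apply: double_inj; rewrite -(@dsum_even quot).
apply/eqP; rewrite -(eqn_add2l n.*2) addnn -e -{1}card_transv -muln2 -sum_nat_const.
rewrite /dsum -big_split /=; apply/eqP/eq_bigr => u uT.
rewrite !degET (@degE quot) !sum_transv -big_split /= (big_setD1 u) //= [RHS](big_setD1 u) //=.
rewrite quot_adj_irrefl add0n !adj_irrefl adjm adjmC; congr (_ + _)%N.
apply: eq_bigr => v; rewrite in_setD1 => /andP[vu vT]; rewrite one_edge //; first by rewrite eq_sym.
by apply: contraTneq uT => ->; rewrite transv_m vT.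
Qed.

Definition pendant := [set v in T | ~~ nonleaf (m v)].

Local Notation L := pendant.

Lemma pendant_adj u v : u \in T -> v \in L -> adj u (m v) = (u == v).
Proof.
move=> uT; rewrite in_set => /andP[vT nl]; apply/idP/eqP => [uv|->]; last exact: adjm.
by rewrite adj_sym in uv; rewrite (leaf_nbr nl uv) mK.
Qed.

Lemma pendant_sub v : v \in L -> v \in T.
Proof. by rewrite in_set => /andP[]. Qed.

Lemma pendant_adj_m u v : u \in T -> v \in L -> ~~ adj (m u) (m v).
Proof.
move=> uT vL; have vT := pendant_sub vL; move: vL; rewrite in_set => /andP[_ nl].
apply/negP; rewrite adj_sym => /(leaf_nbr nl); rewrite mK => e.
by have := transv_m u; rewrite e vT uT.
Qed.

Lemma transv_neqm u v : u \in T -> v \in T -> u != m v.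
Proof. by move=> uT vT; apply: contraTneq uT => ->; rewrite transv_m vT. Qed.

Lemma quot_adj_pendant : {in L &, quot_adj =2 adj}.
Proof.
move=> u v uL vL; have [uT vT] := (pendant_sub uL, pendant_sub vL).
rewrite /quot_adj (transv_neqm uT vT) (negPf (pendant_adj_m uT vL)) orbF.
rewrite [adj (m u) v]adj_sym !pendant_adj // [v == u]eq_sym.
by have [->|] := eqVneq u v; rewrite ?adj_irrefl ?orbF.
Qed.

Section QuotientPolynomial.
Variables (F : fieldType) (x : F).
Hypothesis x1 : 1 + x != 0.

Lemma ip_pendantL A : A \subset L ->
  ip (A :|: m @: L) x = (1 + x) ^+ #|L| * ip A (x / (1 + x)).
Proof.
move=> AL; apply: ip_pendant => // u v uL vL; first exact/pendant_adj/vL/pendant_sub.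
exact/pendant_adj_m/vL/pendant_sub.
Qed.


(** If every matching edge is pendant, [ip_pendant] applies directly. Otherwise both ends of the
    single exceptional edge are deleted; their only other neighbours are [a] and [b]. *)
Lemma ip_quot : ip [set: G] x = (1 + x) ^+ n * @ip quot F T (x / (1 + x)).
Proof.
have [/exists_inP[z zT nmz]|all_leaf] := boolP [exists z in T, nonleaf (m z)]; last first.
  have eL : L = T.
    apply/setP => v; rewrite in_set; have [vT|//] := boolP (v \in T).
    by apply: contra all_leaf => nl; apply/exists_inP; exists v.
  rewrite (_ : [set: G] = L :|: m @: L); last by rewrite eL -transvC setUCr.
  rewrite ip_pendantL // eL card_transv; congr (_ * _); apply/esym/eq_ip.
  by rewrite -eL; exact: quot_adj_pendant.
have nz : nonleaf z by move: zT; rewrite in_set => /andP[].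
have mzT : m z \notin T by rewrite transv_m zT.
have eL : L = T :\ z.
  apply/setP => v; rewrite in_setD1 [v \in L]in_set.
  have [vT|] := boolP (v \in T); rewrite ?andbF //= andbT.
  have [->|vz] := eqVneq v z; first by rewrite nmz.
  apply/negP => nmv; have nv : nonleaf v by move: vT; rewrite in_set => /andP[].
  have [e|e] := nonleaf_pair_uniq nz nmz nv nmv; first by rewrite e eqxx in vz.
  by rewrite e (negPf mzT) in vT.
have [a /andP[az za]] := existsP nz; have [b] := existsP nmz.
rewrite mK => /andP[bz mb].
have ab := complete za az mb bz.
have inL v : nonleaf v -> v != z -> v != m z -> v \in L.
  move=> nv vz vmz; have nl : ~~ nonleaf (m v).
    apply/negP => nmv; have [e|e] := nonleaf_pair_uniq nz nmz nv nmv.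
      by rewrite e eqxx in vz.
    by rewrite e eqxx in vmz.
  by rewrite in_set nl andbT in_set nv nl.
have aL : a \in L.
  apply: inL => //; last by rewrite eq_sym adj_neq.
  by apply: (@nonleafI a z); rewrite 1?adj_sym // eqmC eq_sym.
have bL : b \in L.
  apply: inL => //; last by rewrite eq_sym adj_neq.
  by apply: (@nonleafI b (m z)); rewrite 1?adj_sym // eqm eq_sym.
have nbz v : v != m z -> adj z v = (v == a).
  move=> vm; apply/idP/eqP => [zv|->//]; exact: nonleaf_nbr_uniq nmz zv vm za az.
have nbmz v : v != z -> adj (m z) v = (v == b).
  move=> vz; apply/idP/eqP => [zv|->//].
  by apply: nonleaf_nbr_uniq _ zv _ mb _; rewrite mK.
have LT v : v \in L -> v != z by rewrite eL !inE => /andP[].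
have Lm v : v \in L -> v != m z by move=> /pendant_sub vT; exact: transv_neqm.
have eK : [set: G] :\ z :\ m z = L :|: m @: L.
  apply/setP => v; rewrite in_setU eL !in_setD1 in_setT andbT.
  have -> : (v \in m @: (T :\ z)) = (v != m z) && (v \notin T).
    apply/imsetP/andP => [[w] + ->|[vz vT]].
      by rewrite in_setD1 transv_m eqm => /andP[-> ->].
    by exists (m v); rewrite ?mK // in_setD1 transv_m -eqmC vz.
  have [->|vz] := eqVneq v (m z); first by rewrite (negPf mzT) andbF.
  by have [->|] := eqVneq v z; rewrite ?zT //=; case: (v \in T).
have dropL c : c \in L -> (L :|: m @: L) :\ c = (L :\ c) :|: m @: L.
  move=> cL; apply/setP => v; rewrite !inE andb_orr; congr (_ || _).
  apply: andb_idl => /imsetP[w wL ->]; rewrite eq_sym.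
  by apply: transv_neqm; exact: pendant_sub.
rewrite (ip_del _ (in_setT z)) (@ip_del _ _ _ (m z)); last by rewrite !inE eq_sym neqm.
have -> : ndel [set: G] z = (L :|: m @: L) :\ a.
  rewrite -eK; apply/setP => v; rewrite !inE !andbT.
  have [->|vz] := eqVneq v z; rewrite /= ?andbF // andbT.
  have [->|vm] := eqVneq v (m z); first by rewrite adjm andbF.
  by rewrite nbz // andbT.
have -> : ndel ([set: G] :\ z) (m z) = (L :|: m @: L) :\ b.
  rewrite -eK; apply/setP => v; rewrite !inE !andbT.
  have [->|vz] := eqVneq v z; rewrite /= ?andbF // andbT.
  by rewrite nbmz // andbC.
rewrite eK !dropL // !ip_pendantL ?subD1set //.
have -> : n = #|L|.+1 by rewrite -card_transv (cardsD1 z) zT -eL.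
rewrite (@ip_del quot F T z) // -[T :\ z]eL.
have -> : @ndel quot T z = L :\ a :\ b.
  apply/setP => v; rewrite in_set -eL !in_setD1.
  have [vL|] := boolP (v \in L); rewrite ?andbF //= /quot_adj.
  have vT := pendant_sub vL; rewrite (transv_neqm zT vT) eq_sym (LT v vL) /=.
  rewrite (pendant_adj zT vL) (negPf (pendant_adj_m zT vL)) orbF nbz ?Lm // nbmz ?LT //.
  by rewrite [z == v]eq_sym (negPf (LT v vL)) /= negb_or andbT andbC.
set y := x / _.
have eqL A : A \subset L -> @ip quot F A y = ip A y.
  by move=> /subsetP AL; apply: eq_ip => u v /AL uL /AL vL; exact: quot_adj_pendant.
rewrite (eqL L) // (eqL (L :\ a :\ b)); last first.
  by apply: subset_trans (subD1set _ _) (subD1set _ _).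
(* As [a] and [b] are adjacent, no independent set contains both: [ip (L :\ a) y + ip (L :\ b) y =
   ip L y + ip (L :\ a :\ b) y]. The final [field] uses this. *)
have e1 := ip_del y aL; have e2 : ip (L :\ b) y = ip (L :\ a :\ b) y + y * ip (ndel L a) y.
  rewrite (@ip_del _ _ (L :\ b) a); last by rewrite in_setD1 aL adj_neq.
  have -> : L :\ b :\ a = L :\ a :\ b by apply/setP => v; rewrite !in_setD1 andbCA.
  suff -> : ndel (L :\ b) a = ndel L a by [].
  apply/setP => v; rewrite [in LHS]in_set [in RHS]in_set !in_setD1.
  by have [->|] := eqVneq v b; rewrite ?ab ?andbF.
rewrite e2 e1 exprS /y; field.
exact: x1.
Qed.

End QuotientPolynomial.
End Quotient.

(** * Cycles, graph stars and conclusion *)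

Lemma ip_imset (G1 G2 : graph) (f : G1 -> G2) (K : nzSemiRingType) (S : {set G1}) (x : K) :
  injective f -> (forall u v, adj (f u) (f v) = adj u v) -> ip (f @: S) x = ip S x.
Proof.
move=> finj fadj; elim/set_ind: S => S IH.
have [->|[v vS]] := set_0Vmem S; first by rewrite imset0 !ip0.
have fD : f @: S :\ f v = f @: (S :\ v).
  by apply/setP => w; apply/setD1P/imsetP => [[wv /imsetP[u uS e]]|[u /setD1P[uv uS] ->]];
    [exists u; rewrite // !inE uS andbT; apply: contra wv => /eqP<-; rewrite e
    | rewrite (inj_eq finj) uv imset_f].
rewrite (ip_del _ vS) (@ip_del _ _ _ (f v)) ?imset_f // fD.
have -> : ndel (f @: S) (f v) = f @: ndel S v.
  apply/setP => w; rewrite in_set fD; apply/andP/imsetP => [[/imsetP[u uS ->]]|[u]].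
    by rewrite fadj => uv; exists u; rewrite // in_set uS.
  by rewrite in_set => /andP[uS uv] ->; rewrite fadj imset_f.
rewrite !IH ?properD1 //; exact: sub_proper_trans (ndel_sub S v) (properD1 vS).
Qed.

Lemma ip_star (G : graph) (F : fieldType) (x : F) : 1 + x != 0 ->
  ip [set: star G] x = (1 + x) ^+ #|G| * ip [set: G] (x / (1 + x)).
Proof.
move=> x1; pose f : G -> star G := inl.
have finj : injective f by move=> u v [].
pose l (v : star G) : star G := match v with inl u => inr u | inr u => inl u end.
have e : [set: star G] = f @: [set: G] :|: l @: (f @: [set: G]).
  apply/esym/eqP; rewrite -subTset; apply/subsetP => -[u|u] _; rewrite inE.
    by rewrite (@imset_f _ _ f) ?inE.
  by rewrite (@imset_f _ _ l (f @: setT) (inl u)) ?orbT // (@imset_f _ _ f).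
rewrite e ip_pendant //.
- by rewrite card_imset // cardsT (@ip_imset G (star G) f).
- by move=> _ _ /imsetP[u _ ->] /imsetP[v _ ->]; rewrite /= (inj_eq finj).
by move=> _ _ /imsetP[u _ ->] /imsetP[v _ ->].
Qed.

(** * Polynomials of the cycle and of [U_n] *)

Section CycleGraphPolynomial.
Variables (n : nat) (F : comNzRingType) (x : F).

Lemma cycle_adj_lt (u v : 'I_n) : (u < v)%N ->
  cycle_adj u v = (u.+1 == v :> nat) || (u == 0%N :> nat) && (v.+1 == n).
Proof.
move=> uv; rewrite /cycle_adj -!val_eqE /= (ltn_eqF uv) /=.
rewrite modn_small; last exact: leq_ltn_trans uv (ltn_ord v).
rewrite eq_sym; congr (_ || _).
have [->|vn] := eqVneq v.+1 n; first by rewrite modnn andbT.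
rewrite modn_small ?andbF; first by apply/negbTE; rewrite neq_ltn (ltn_trans uv).
by rewrite ltn_neqAle vn ltn_ord.
Qed.

Definition segment j k : {set cycle_graph n} := [set i : 'I_n | (j <= i < j + k)%N].

(** Fewer than [n] consecutive vertices cannot contain both ends of the wrap-around edge, so they
    induce a path. *)
Lemma ip_segment j k : (j + k <= n)%N -> (k < n)%N -> ip (segment j k) x = qp x k.+1.
Proof.
have [m] := ubnP k; elim: m k => // m IH [|k] km jk kn.
  rewrite (_ : segment j 0 = set0) ?ip0 //.
  by apply/setP => i; rewrite !inE; lia.
have vn : (j + k < n)%N by rewrite -addnS.
pose v : cycle_graph n := Ordinal vn.
rewrite (@ip_del _ _ _ v) ?inE /=; last by lia.
have -> : segment j k.+1 :\ v = segment j k.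
  by apply/setP => i; rewrite !inE -val_eqE /=; lia.
have -> : ndel (segment j k.+1) v = segment j k.-1.
  apply/setP => i; rewrite !inE -val_eqE /=.
  have [iv|vi] := ltnP i (j + k); last by lia.
  by rewrite cycle_adj_sym (@cycle_adj_lt i v) //=; lia.
rewrite !IH; try lia.
(* For [k = 0] the truncated [k.-1] is harmless, since [qp x 0 = qp x 1]. *)
by case: k {km jk kn vn v} => [|k].
Qed.

Lemma ip_cycle_graph : (3 <= n)%N -> ip [set: cycle_graph n] x = cp x n.
Proof.
move=> n3; have vn : (n.-1 < n)%N by lia.
pose v : cycle_graph n := Ordinal vn.
rewrite (ip_del _ (in_setT v)).
have -> : setT :\ v = segment 0 n.-1.
  by apply/setP => i; rewrite !inE -val_eqE /=; have := ltn_ord i; lia.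
have -> : ndel setT v = segment 1 (n - 3).
  apply/setP => i; rewrite !inE -val_eqE /=; have := ltn_ord i.
  have [iv|vi] := ltnP i n.-1; last by lia.
  by rewrite cycle_adj_sym (@cycle_adj_lt i v) //=; lia.
rewrite !ip_segment; try lia.
by case: n n3 => [|[|[|k]]] // _; rewrite subSS subSS subSS subn0 cpE.
Qed.

End CycleGraphPolynomial.

(** Deleting the centre leaves one edge and [n - 3] isolated vertices; selecting it leaves
    nothing. *)
Lemma ip_U_graph n (F : rcfType) (x : F) : (3 <= n)%N ->
  ip [set: U_graph n] x = up (n - 3) x.
Proof.
move=> n3.
have [n0 n1 n2] : [/\ 0 < n, 1 < n & 2 < n]%N by split; lia.
pose o0 : U_graph n := Ordinal n0; pose o1 : U_graph n := Ordinal n1.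
pose o2 : U_graph n := Ordinal n2.
rewrite (ip_del _ (in_setT o0)).
have -> : ndel setT o0 = set0.
  apply/setP => i; rewrite !inE /= /U_adj /= andbT [o0 == i]eq_sym.
  by case: (i == o0).
pose P : {set U_graph n} := [set i : 'I_n | (2 < i)%N].
have -> : [set: U_graph n] :\ o0 = [set o1; o2] :|: P.
  by apply/setP => i; rewrite !inE -!val_eqE /=; lia.
rewrite ipU; first last.
- move=> u v; rewrite !inE -!val_eqE /= /U_adj => hu hv; lia.
- by rewrite -setI_eq0; apply/eqP/setP => i; rewrite !inE -!val_eqE /=; lia.
rewrite ip_set2 // ip0 mulr1 /up mulrC; congr (_ * _ + _).
rewrite ip_independent; last first.
  by apply/independentP => u v; rewrite !inE /= /U_adj => hu hv; lia.
congr (_ ^+ _).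
have -> : P = ~: [set o0; o1; o2].
  by apply/setP => i; rewrite !inE -!val_eqE /=; lia.
by rewrite cardsCs setCK card_ord -setUA cardsU1 cards2 !inE.
Qed.

(** * Passage to the contraction and conclusion *)

Section Transfer.
Variables (R : realType) (A B : graph) (n : nat) (T : {set B}).
Hypothesis ipAB : forall x : R, 1 + x != 0 ->
  ip [set: A] x = (1 + x) ^+ n * ip T (x / (1 + x)).

(** [y / (1 + y)] maps [[x, 0]] onto [[x / (1 + x), 0]] and the factor [(1 + y) ^+ n] is positive
    there, so [pos_good] applies to [T]. *)
Lemma transfer_good (r x : R) : -1 <= r -> (forall y, r < y <= 0 -> 0 < ip [set: A] y) ->
  r < x <= 0 -> good T (x / (1 + x)).
Proof.
move=> r1 pos /andP[rx x0]; have x1 : 0 < 1 + x by lra.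
apply: pos_good; first by rewrite pmulr_lle0 ?invr_gt0.
move=> z /andP[xz z0].
have z1 : 0 < 1 - z by lra.
pose w := z / (1 - z).
have w1 : 1 + w = (1 - z)^-1 by rewrite /w; field; lra.
have ew : w / (1 + w) = z by rewrite w1 invrK /w divfK //; lra.
have w1p : 0 < 1 + w by rewrite w1 invr_gt0.
have xw : x <= w.
  rewrite /w ler_pdivlMr //; move: xz; rewrite ler_pdivrMr //; lra.
have w0 : w <= 0 by rewrite /w pmulr_lle0 ?invr_gt0.
have := pos w; rewrite (lt_le_trans rx xw) w0 => /(_ isT).
by rewrite ipAB ?gt_eqF // ew pmulr_rgt0 // exprn_gt0.
Qed.

End Transfer.

(** At 0 both polynomials equal 1, and at the root the inequality follows by continuity, so the open
    interval suffices. *)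
Lemma preceq_intro (R : realType) (H G : graph) : [set: G] != set0 ->
  (forall r x : R, -1 <= r -> (forall y, r < y <= 0 -> 0 < ip [set: G] y) ->
     r < x -> x < 0 -> ip [set: G] x <= ip [set: H] x) ->
  preceq R H G.
Proof.
move=> /(largest_root R)[r [/andP[r1 r0] ipr pos]] h.
exists r; first exact: is_xi_largest_root.
have open x : r < x <= 0 -> (indep_poly R G).[x] <= (indep_poly R H).[x].
  rewrite !horner_indep_poly => /andP[rx]; rewrite le_eqVlt => /predU1P[->|x0].
    by rewrite !ip_at0.
  exact: (h r).
move=> x /andP[rx x0]; move: rx; rewrite le_eqVlt => /predU1P[<-|rx].
  exact: (le_left_limit r0 open).
by apply: open; rewrite rx.
Qed.

Lemma well_covered_unicyclic_quotient (n : nat) (G : graph) : (3 <= n)%N ->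
  #|G| = (2 * n)%N -> well_covered G -> connected_unicyclic G ->
  exists (H : graph) (T : {set H}), [/\ conn T, ne T = n, #|T| = n &
    forall (F : fieldType) (x : F), 1 + x != 0 ->
      ip [set: G] x = (1 + x) ^+ n * ip T (x / (1 + x))].
Proof.
move=> hn; rewrite mul2n => cG wcG uG.
have cT := connected_conn (proj1 uG).
have noiso (v : G) : exists u, adj v u.
  have [|u _ vu] := conn_neighbor cT (in_setT v); last by exists u.
  by rewrite cardsT cG; lia.
have [eG [a dG]] := unicyclic_counts uG.
have [I [_ iI leI]] := forest_independent dG.
have [S mS IS] := maximal_independent iI.
(* The forest has [2n - 1] vertices, so by parity its independent set has at least [n]. *)
have nS : (n <= #|S|)%N.
  have cD := cardsD1 a [set: G]; rewrite inE cardsT cG in cD.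
  have le : (#|I| <= #|S|)%N := subset_leq_card IS.
  by move: cD leI le; lia.
have [cS [m [mK adjm mS']]] := perfect_matching wcG noiso cG mS nS.
have complete := matching_complete wcG cG mS cS mK adjm.
exists (quot mK), (transv m S); split.
- exact: (quot_conn uG hn cG mK mS').
- exact: (quot_ne uG hn cG mK adjm mS' complete eG).
- exact: (card_transv uG hn cG mK mS').
by move=> F x x1; exact: (ip_quot uG hn cG mK adjm mS' complete).
Qed.

Theorem theorem3p12 (R : realType) (n : nat) (hn : (3 <= n)%N) (G : graph)
    (Gorder : #|G| = (2 * n)%N) (Gwc : well_covered G)
    (Guni : connected_unicyclic G) :
  preceq R (star (cycle_graph n)) G /\ preceq R G (star (U_graph n)).
Proof.
have [H [T [cT eT cardT ipG]]] := well_covered_unicyclic_quotient hn Gorder Gwc Guni.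
have n0 : (0 < n)%N by lia.
split; apply: preceq_intro.
- by rewrite -card_gt0 cardsT Gorder; lia.
- move=> r x r1 pos rx x0; have x1 : 0 < 1 + x by lra.
  have x1' : 1 + x != 0 by rewrite gt_eqF.
  have gT : good T (x / (1 + x)).
    by apply: (transfer_good (ipG R) r1 pos); rewrite rx ltW.
  rewrite ipG // ip_star // card_ord ip_cycle_graph // ler_wpM2l ?exprn_ge0 ?(ltW x1) //.
  rewrite -[n in cp _ n]cardT; apply: ip_le_cycle _ cT _ gT.
    by rewrite pmulr_llt0 ?invr_gt0.
  by rewrite eT cardT.
- by apply/set0Pn; exists (inl (Ordinal n0)); rewrite inE.
move=> r x r1 pos rx x0; have x1 : 0 < 1 + x by lra.
have x1' : 1 + x != 0 by rewrite gt_eqF.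
have ipU y : 1 + y != 0 -> ip [set: star (U_graph n)] y =
    (1 + y) ^+ n * ip [set: U_graph n] (y / (1 + y)) :> R.
  by move=> y1; rewrite ip_star // card_ord.
have gU : good [set: U_graph n] (x / (1 + x)).
  by apply: (transfer_good ipU r1 pos); rewrite rx ltW.
rewrite ipG // ipU // ler_wpM2l ?exprn_ge0 ?(ltW x1) // ip_U_graph //.
set y := x / _ in gU *.
have y0 : y < 0 by rewrite pmulr_llt0 ?invr_gt0.
apply: unicyclic_ip_ge; rewrite ?eT ?cardT ?ltW //; last 2 first.
(* Positivity on the edge joining 0 and 1 gives [1 + 2y > 0]. *)
- have n1 : (1 < n)%N by lia.
  have := gU [set Ordinal n0; Ordinal n1] (subsetT _).
  by rewrite ip_set2 //; lra.
- by rewrite -ip_U_graph //; exact: gU.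
by lia.
Qed.
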